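(* Let $n>1$ be an integer, let $\Sigma$ be the finite topological space defined in the context, and let $\sim$ be the equivalence relation on $\Sigma$ defined in the context. Then the quotient space $\Sigma/\!\sim$ satisfies $\pi_1(\Sigma/\!\sim)\cong \mathbb{Z}_n=\mathbb{Z}/n\mathbb{Z}$.
   Context: $\Sigma=A\cup A'\cup B\cup B'\cup C$ is the disjoint union of the sets of distinct elements $A=\{a_1,\dots,a_n\}$, $A'=\{a'_1,\dots,a'_{2n}\}$, $B'=\{b'_1,\dots,b'_{2n}\}$, $B=\bigcup_{i=1}^n B_i$ with $B_i=\{b_{i,1},\dots,b_{i,2n}\}$, and $C=\bigcup_{i=1}^n C_i$ with $C_i=\{c_{i,1},\dots,c_{i,2n}\}$. The first index of $b_{i,j},c_{i,j}$ and the index of $a_i$ are taken mod $n$; the second index of $b_{i,j},c_{i,j}$ and the indices of $a'_i,b'_i$ are taken mod $2n$. The topology on $\Sigma$ has as basis the empty set together with the sets $U_{c_{i,j}}=\{c_{i,j}\}$; $U_{b_{i,j}}=\{c_{i,j-1},b_{i,j},c_{i,j}\}$; $U_{b'_i}=\{c_{1,i},\dots,c_{n,i},b'_i\}$; $U_{a_i}=B_i\cup C_i\cup\{a_i\}$; $U_{a'_i}=\{b'_{i-1},a'_i,b'_i\}\cup\bigcup_{j=1}^n U_{b_{j,i}}=\{b'_{i-1},a'_i,b'_i,b_{1,i},c_{1,i-1},c_{1,i},\dots,b_{n,i},c_{n,i-1},c_{n,i}\}$. The equivalence relation $\sim$ on $\Sigma$ is: $a'_i\sim a'_j$ iff $i\equiv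 j \pmod 2$; $a_i\sim a_j$ for all $1\le i,j\le n$; $b'_i\sim b'_j$ iff $i\equiv j\pmod 2$; $b_{i,s}\sim b_{j,t}$ iff $2(j-i)\equiv t-s \pmod{2n}$; $c_{i,s}\sim c_{j,t}$ iff $2(j-i)\equiv t-s\pmod{2n}$; and no elements of different types are equivalent. $\Sigma/\!\sim$ carries the quotient topology. *)

(* Defs.v *)
From HB Require Import structures.
From mathcomp Require Import all_boot all_order all_algebra generic_quotient.
From mathcomp Require Import all_classical all_reals all_analysis homotopy.
From mathcomp Require Import ring lra.
Import Order.TTheory GRing.Theory Num.Theory.
Import numFieldNormedType.Exports.

Set Implicit Arguments.
Unset Strict Implicit.
Unset Printing Implicit Defensive.

Local Open Scope classical_set_scope.
Local Open Scope ring_scope.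
Local Open Scope quotient_scope.

(* An index taken mod m is an element of 'I_m, the representative of m being 0,
   and [ord_pred] is cyclic predecessor: it sends j to j - 1 mod m. *)
Inductive Sigma (n : nat) : Type :=
| Sa of 'I_n
| Sa' of 'I_(2 * n)
| Sb' of 'I_(2 * n)
| Sb of 'I_n & 'I_(2 * n)
| Sc of 'I_n & 'I_(2 * n).

Section SigmaFinite.
Variable n : nat.

Let code : Type :=
  ('I_n + ('I_(2 * n) + 'I_(2 * n)) +
     ('I_n * 'I_(2 * n) + 'I_n * 'I_(2 * n)))%type.

Definition Sigma_encode (x : Sigma n) : code :=
  match x with
  | Sa i => inl (inl i)
  | Sa' i => inl (inr (inl i))
  | Sb' i => inl (inr (inr i))
  | Sb i j => inr (inl (i, j))
  | Sc i j => inr (inr (i, j))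
  end.

Definition Sigma_decode (x : code) : Sigma n :=
  match x with
  | inl (inl i) => Sa i
  | inl (inr (inl i)) => Sa' i
  | inl (inr (inr i)) => Sb' i
  | inr (inl (i, j)) => Sb i j
  | inr (inr (i, j)) => Sc i j
  end.

Lemma Sigma_encodeK : cancel Sigma_encode Sigma_decode.
Proof. by case. Qed.

HB.instance Definition _ := Finite.copy (Sigma n) (can_type Sigma_encodeK).

End SigmaFinite.

Section SigmaTopology.
Variable n : nat.

Definition Sigma_U (x : Sigma n) : set (Sigma n) :=
  match x with
  | Sc i j => [set Sc i j]
  | Sb i j => [set Sc i (ord_pred j); Sb i j; Sc i j]
  | Sb' i => [set Sc k i | k in [set: 'I_n]] `|` [set Sb' i]
  | Sa i => [set Sb i j | j in [set: 'I_(2 * n)]] `|`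
            [set Sc i j | j in [set: 'I_(2 * n)]] `|` [set Sa i]
  | Sa' i => [set Sb' (ord_pred i); Sa' i; Sb' i] `|`
             \bigcup_(j : 'I_n) [set Sc j (ord_pred i); Sb j i; Sc j i]
  end.

(* [None] stands for the empty basic set. *)
Definition Sigma_basis (o : option (Sigma n)) : set (Sigma n) :=
  if o is Some x then Sigma_U x else set0.

Lemma Sigma_U_refl x : Sigma_U x x.
Proof.
by case: x => /= [i|i|i|i j|i j] //; [right|left; left; right|right|left; right].
Qed.

Lemma Sigma_U_sub x y : Sigma_U x y -> Sigma_U y `<=` Sigma_U x.
Proof.
case: x => [i|i|i|i j|i j] /=.
- case=> [[[j _ <-]|[j _ <-]]|->] z //=.
  + by case=> [[->|->]|->]; left; [right; exists (ord_pred j)|left; exists j|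
                                    right; exists j].
  + by move=> ->; left; right; exists j.
- case=> [[[->|->]|->]|[j _ [[->|->]|->]]] z //=.
  + case=> [[k _ <-]|->]; last by left; left; left.
    by right; exists k => //; left; left.
  + case=> [[k _ <-]|->]; last by left; right.
    by right; exists k => //; right.
  + by move=> ->; right; exists j => //; left; left.
  + by move=> ?; right; exists j.
  + by move=> ->; right; exists j => //; right.
- by case=> [[k _ <-]|->] z //= ->; left; exists k.
- by case=> [[->|->]|->] z //= ->; [left; left|right].
- by move=> ->.
Qed.

Lemma Sigma_basis_cover :
  \bigcup_(o in [set: option (Sigma n)]) Sigma_basis o = setT.
Proof. by rewrite -subTset => x _; exists (Some x) => //; exact: Sigma_U_refl. Qed.

Lemma Sigma_basis_join (o1 o2 : option (Sigma n)) (t : Sigma n) :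
  [set: option (Sigma n)] o1 -> [set: option (Sigma n)] o2 ->
  Sigma_basis o1 t -> Sigma_basis o2 t ->
  exists o, [/\ [set: option (Sigma n)] o, Sigma_basis o t &
                Sigma_basis o `<=` Sigma_basis o1 `&` Sigma_basis o2].
Proof.
case: o1 o2 => [x|//] [y|//] _ _ /= xt yt; exists (Some t); split => //=.
  exact: Sigma_U_refl.
by move=> z tz; split; [exact: Sigma_U_sub xt _ tz|exact: Sigma_U_sub yt _ tz].
Qed.

HB.instance Definition _ := @isBaseTopological.Build (Sigma n)
  (option (Sigma n)) [set: option (Sigma n)] Sigma_basis
  Sigma_basis_cover Sigma_basis_join.

End SigmaTopology.

Section SigmaQuotient.
Variable n : nat.

Definition Sigma_sim (x y : Sigma n) : bool :=
  match x, y with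
  | Sa _, Sa _ => true
  | Sa' i, Sa' j => (i == j %[mod 2])%N
  | Sb' i, Sb' j => (i == j %[mod 2])%N
  | Sb i s, Sb j t | Sc i s, Sc j t =>
      (2%:Z * (j%:Z - i%:Z) == t%:Z - s%:Z %[mod (2 * n)%:Z])%Z
  | _, _ => false
  end.

Lemma Sigma_sim_refl : reflexive Sigma_sim.
Proof. by case=> //= *; rewrite ?subrr ?mulr0. Qed.

Lemma Sigma_sim_sym : symmetric Sigma_sim.
Proof.
have E (u v : int) :
    (u == v %[mod (2 * n)%:Z])%Z = (- u == - v %[mod (2 * n)%:Z])%Z.
  by rewrite !eqz_mod_dvd -opprD rpredN.
case=> [i|i|i|i s|i s] [j|j|j|j t|j t] //=.
1,2: by rewrite E -mulrN !opprB.
Qed.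

Lemma Sigma_sim_trans : transitive Sigma_sim.
Proof.
have E (i j k s t u : int) :
    (2 * (j - i) == t - s %[mod (2 * n)%:Z])%Z ->
    (2 * (k - j) == u - t %[mod (2 * n)%:Z])%Z ->
    (2 * (k - i) == u - s %[mod (2 * n)%:Z])%Z.
  rewrite !eqz_mod_dvd => h1 h2.
  have -> : 2 * (k - i) - (u - s) =
    (2 * (j - i) - (t - s)) + (2 * (k - j) - (u - t)) by ring.
  exact: rpredD.
case=> [i|i|i|i s|i s] [j|j|j|j t|j t] [k|k|k|k u|k u] //=.
1,2: by move=> /eqP -> /eqP ->.
1,2: by move=> h1 h2; exact: E h1 h2.
Qed.

Canonical Sigma_sim_equiv :=
  EquivRel Sigma_sim Sigma_sim_refl Sigma_sim_sym Sigma_sim_trans.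

End SigmaQuotient.

Definition SigmaQ (n : nat) : topologicalType :=
  quotient_topology {eq_quot (Sigma_sim_equiv n)}.

Definition unit_interval (R : realType) : Type := set_type `[0%R : R, 1%R]%classic.

Section UnitInterval.
Variable R : realType.
Local Notation I := (unit_interval R).

HB.instance Definition _ := Topological.copy I (set_type `[0%R : R, 1%R]%classic).

Definition uival (t : I) : R := set_val t.

Lemma uival_itv (t : I) : 0 <= uival t <= 1.
Proof. by have := set_valP t; rewrite /= in_itv. Qed.

Lemma uival_continuous : continuous uival.
Proof. exact: initial_continuous. Qed.

Lemma uival_inj : injective uival.
Proof. exact: val_inj. Qed.

Lemma uclamp_subproof (x : R) :
  Num.max 0 (Num.min x 1) \in `[0%R : R, 1%R]%classic.
Proof. by rewrite inE /= in_itv /= le_max lexx /= ge_max ler01 ge_min lexx orbT. Qed.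

(* The retraction of the line onto the unit interval. *)
Definition uclamp (x : R) : I := SigSub (uclamp_subproof x).

Lemma uclampE x : uival (uclamp x) = Num.max 0 (Num.min x 1).
Proof. by rewrite /uival set_valE. Qed.

Lemma uclampK (t : I) : uclamp (uival t) = t.
Proof.
apply: uival_inj; rewrite uclampE; have /andP[t0 t1] := uival_itv t.
by rewrite min_l// max_r.
Qed.

End UnitInterval.

Section UnitIntervalPath.
Variable R : realType.
Local Notation I := (unit_interval R).

Lemma uclamp_continuous : continuous (@uclamp R).
Proof.
have cv : continuous (fun x : R => Num.max 0 (Num.min x 1)).
  apply: (@max_fun_continuous _ R R); first by move=> x; exact: cvg_cst.
  by apply: (@min_fun_continuous _ R R) => x; [exact: cvg_id|exact: cvg_cst].
apply/continuousP => _ [A oA <-]; rewrite -comp_preimage.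
by move/continuousP: cv; exact.
Qed.

Lemma uclamp01_neq : uclamp 0 != uclamp 1 :> I.
Proof.
apply/eqP => /(congr1 (@uival R)); rewrite !uclampE !minxx (min_l ler01) maxxx.
by rewrite (max_r ler01) => /eqP; rewrite eq_sym oner_eq0.
Qed.

HB.instance Definition _ :=
  @isBiPointed.Build I (uclamp 0) (uclamp 1) uclamp01_neq.

Lemma uclamp_le0 (x : R) : x <= 0 -> uclamp x = zero.
Proof.
move=> x0; apply: uival_inj; rewrite !uclampE (min_l ler01) maxxx.
by rewrite min_l ?max_l// (le_trans x0).
Qed.

Lemma uclamp_ge1 (x : R) : 1 <= x -> uclamp x = one.
Proof.
by move=> x1; apply: uival_inj; rewrite !uclampE minxx (max_r ler01) min_r ?max_r.
Qed.

Lemma uival0 : uival (zero : I) = 0.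
Proof. by rewrite uclampE (min_l ler01) maxxx. Qed.

Lemma uival1 : uival (one : I) = 1.
Proof. by rewrite uclampE minxx (max_r ler01). Qed.

Lemma uclamp_id (x : R) : 0 <= x <= 1 -> uival (uclamp x) = x.
Proof. by move=> /andP[x0 x1]; rewrite uclampE min_l// max_r. Qed.

End UnitIntervalPath.

Lemma pasting_continuous (R : realType) (Y Z : topologicalType)
    (u : Y -> R) (c : R) (f g : Y -> Z) :
  continuous u -> continuous f -> continuous g ->
  (forall y, u y = c -> f y = g y) ->
  continuous (fun y => if u y <= c then f y else g y).
Proof.
move=> cu cf cg fg y A; case: (ltgtP (u y) c) => uyc.
- move=> /cf fA; have : nbhs y [set z | u z < c].
    by apply: (cu y [set r | r < c]); exact: lt_nbhsl.
  move=> ult; near_simpl; near=> z.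
  by rewrite ifT; [near: z|apply/ltW; near: z].
- move=> /cg gA; have : nbhs y [set z | c < u z].
    by apply: (cu y [set r | c < r]); exact: lt_nbhsr.
  move=> ugt; near_simpl; near=> z.
  rewrite ifF; [by near: z|apply/negbTE; rewrite -ltNge; near: z; exact: ugt].
- move=> nA; have gA := nA; rewrite (fg _ uyc) in gA.
  have {}nA := cf _ _ nA; have {}gA := cg _ _ gA.
  near_simpl; near=> z; case: ifPn => _; near: z; [exact: nA|exact: gA].
Unshelve. all: by end_near. Qed.

Section Homotopy.
Variables (R : realType) (X : topologicalType).
Local Notation I := (unit_interval R).
Implicit Types x y z : X.

(* Homotopy relative to the endpoints. *)
Definition path_homotopy x y (p q : {path I from x to y}) : Prop :=
  exists H : (I * I)%type -> X,
    [/\ continuous H,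
        (forall t, H (t, zero) = p t), (forall t, H (t, one) = q t),
        (forall s, H (zero, s) = x) & (forall s, H (one, s) = y)].

(* [uclamp] is the identity on the arguments it receives in either branch. *)
Definition path_concat_fun x y z (p : {path I from x to y})
    (q : {path I from y to z}) (t : I) : X :=
  if uival t <= 2^-1 then p (uclamp (2 * uival t))
  else q (uclamp (2 * uival t - 1)).

Let affine_cts (Y : topologicalType) (u : Y -> R) (a b : R) :
  continuous u -> continuous (fun v => a * u v + b).
Proof.
move=> cu v; apply: (@cvgD _ R^o); last exact: cvg_cst.
by apply: cvgM; [exact: cvg_cst|exact: cu].
Qed.

Let comp_cts (A B C : topologicalType) (f : A -> B) (g : B -> C) :
  continuous f -> continuous g -> continuous (fun a => g (f a)).
Proof. by move=> cf cg a; apply: continuous_comp; [exact: cf|exact: cg]. Qed.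

Lemma path_concat_cts x y z (p : {path I from x to y})
  (q : {path I from y to z}) : continuous (path_concat_fun p q).
Proof.
apply: (@pasting_continuous R); first exact: uival_continuous.
- apply: comp_cts; last exact: cts_fun.
  apply: comp_cts; last exact: uclamp_continuous.
  under eq_fun do rewrite -[2 * _]addr0.
  by apply: affine_cts; exact: uival_continuous.
- apply: comp_cts; last exact: cts_fun.
  apply: comp_cts; last exact: uclamp_continuous.
  by apply: affine_cts; exact: uival_continuous.
- move=> t ->; rewrite uclamp_ge1 ?uclamp_le0 ?path_one ?path_zero//; lra.
Qed.

Lemma path_concat0 x y z (p : {path I from x to y})
  (q : {path I from y to z}) : path_concat_fun p q zero = x.
Proof.
by rewrite /path_concat_fun uival0 invr_ge0 ler0n mulr0 uclamp_le0// path_zero.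
Qed.

Lemma path_concat1 x y z (p : {path I from x to y})
  (q : {path I from y to z}) : path_concat_fun p q one = z.
Proof.
rewrite /path_concat_fun uival1 ifF; last by apply/negbTE; rewrite -ltNge; lra.
by rewrite uclamp_ge1 ?path_one//; lra.
Qed.

Definition path_concat x y z (p : {path I from x to y})
    (q : {path I from y to z}) : {path I from x to z} :=
  mk_path (@path_concat_cts x y z p q) (path_concat0 p q) (path_concat1 p q).

Lemma path_concat_left x y z (p : {path I from x to y})
    (q : {path I from y to z}) (t : I) :
  uival t <= 2^-1 -> path_concat p q t = p (uclamp (2 * uival t)).
Proof. by move=> t2; rewrite /= /mk_path /path_concat_fun t2. Qed.

Lemma path_concat_right x y z (p : {path I from x to y})
    (q : {path I from y to z}) (t : I) :
  2^-1 < uival t -> path_concat p q t = q (uclamp (2 * uival t - 1)).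
Proof. by move=> t2; rewrite /= /mk_path /path_concat_fun leNgt t2. Qed.

Definition path_rev_fun x y (p : {path I from x to y}) (t : I) : X :=
  p (uclamp (1 - uival t)).

Lemma path_rev_cts x y (p : {path I from x to y}) :
  continuous (path_rev_fun p).
Proof.
apply: comp_cts; last exact: cts_fun.
apply: comp_cts; last exact: uclamp_continuous.
under eq_fun do rewrite addrC -mulN1r.
by apply: affine_cts; exact: uival_continuous.
Qed.

Lemma path_rev0 x y (p : {path I from x to y}) : path_rev_fun p zero = y.
Proof. by rewrite /path_rev_fun uival0 uclamp_ge1 ?subr0// path_one. Qed.

Lemma path_rev1 x y (p : {path I from x to y}) : path_rev_fun p one = x.
Proof. by rewrite /path_rev_fun uival1 uclamp_le0 ?subrr// path_zero. Qed.

Definition path_rev x y (p : {path I from x to y}) :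
    {path I from y to x} :=
  mk_path (@path_rev_cts x y p) (path_rev0 p) (path_rev1 p).

Definition path_const x : {path I from x to x} := (cst x : I -> X).

Lemma path_homotopy_reparam x y (r p q : {path I from x to y})
    (f g : R -> R) :
  continuous f -> continuous g ->
  (forall t, p t = r (uclamp (f (uival t)))) ->
  (forall t, q t = r (uclamp (g (uival t)))) ->
  f 0 <= 0 -> g 0 <= 0 -> 1 <= f 1 -> 1 <= g 1 -> path_homotopy p q.
Proof.
move=> cf cg pE qE f0 g0 f1 g1.
pose h (a : I * I) := uival a.2 * (g (uival a.1) - f (uival a.1)) + f (uival a.1).
exists (fun a => r (uclamp (h a))); split.
- apply: comp_cts; last exact: cts_fun.
  apply: comp_cts; last exact: uclamp_continuous.
  have cfst : continuous (fun a : I * I => uival a.1).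
    by apply: comp_cts; [move=> ?; exact: cvg_fst|exact: uival_continuous].
  have csnd : continuous (fun a : I * I => uival a.2).
    by apply: comp_cts; [move=> ?; exact: cvg_snd|exact: uival_continuous].
  have cf' := comp_cts cfst cf; have cg' := comp_cts cfst cg.
  move=> a; apply: (@cvgD _ R^o); last exact: cf'.
  apply: cvgM; first exact: csnd.
  by apply: (@cvgB _ R^o); [exact: cg'|exact: cf'].
- by move=> t; rewrite pE /h /= uival0 mul0r add0r.
- by move=> t; rewrite qE /h /= uival1 mul1r subrK.
- move=> s; rewrite /h /= uival0 uclamp_le0 ?path_zero//.
  by have /andP[] := uival_itv s; nra.
- move=> s; rewrite /h /= uival1 uclamp_ge1 ?path_one//.
  by have /andP[] := uival_itv s; nra.
Qed.

Lemma path_homotopy_refl x y (p : {path I from x to y}) :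
  path_homotopy p p.
Proof.
exists (fun a => p a.1); split => //= *; rewrite ?path_zero ?path_one//.
by apply: comp_cts; [move=> ?; exact: cvg_fst|exact: cts_fun].
Qed.

Lemma path_homotopy_ext x y (p q : {path I from x to y}) :
  p =1 q -> path_homotopy p q.
Proof. by move/path_eqP ->; exact: path_homotopy_refl. Qed.

Lemma pair_cts (A B C : topologicalType) (f : A -> B) (g : A -> C) :
  continuous f -> continuous g -> continuous (fun a => (f a, g a)).
Proof. by move=> cf cg a; apply: cvg_pair; [exact: cf|exact: cg]. Qed.

Let cfst (A B : topologicalType) : continuous (fun a : A * B => a.1).
Proof. by move=> ?; exact: cvg_fst. Qed.

Let csnd (A B : topologicalType) : continuous (fun a : A * B => a.2).
Proof. by move=> ?; exact: cvg_snd. Qed.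

Lemma path_homotopy_sym x y (p q : {path I from x to y}) :
  path_homotopy p q -> path_homotopy q p.
Proof.
move=> [H [cH H0 H1 Hx Hy]].
exists (fun a => H (a.1, uclamp (1 - uival a.2))); split => //=.
- apply: (comp_cts (f := fun a : I * I => (a.1, uclamp (1 - uival a.2)))) => //.
  apply: pair_cts; first exact: cfst.
  apply: comp_cts; last exact: uclamp_continuous.
  under eq_fun do rewrite addrC -mulN1r.
  by apply: affine_cts; apply: comp_cts; [exact: csnd|exact: uival_continuous].
- by move=> t; rewrite uival0 subr0 uclamp_ge1.
- by move=> t; rewrite uival1 subrr uclamp_le0.
Qed.

Lemma path_homotopy_trans x y (q p r : {path I from x to y}) :
  path_homotopy p q -> path_homotopy q r -> path_homotopy p r.
Proof.
move=> [H [cH H0 H1 Hx Hy]] [K [cK K0 K1 Kx Ky]].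
have cs : continuous (fun a : I * I => uival a.2).
  by apply: comp_cts; [exact: csnd|exact: uival_continuous].
exists (fun a => if uival a.2 <= 2^-1 then H (a.1, uclamp (2 * uival a.2))
                 else K (a.1, uclamp (2 * uival a.2 - 1))); split.
- apply: (@pasting_continuous R) => //.
  + apply: (comp_cts (f := fun a : I * I => (a.1, uclamp (2 * uival a.2)))) => //.
    apply: pair_cts; first exact: cfst.
    apply: comp_cts; last exact: uclamp_continuous.
    under eq_fun do rewrite -[2 * _]addr0.
    exact: affine_cts.
  + apply: (comp_cts
      (f := fun a : I * I => (a.1, uclamp (2 * uival a.2 - 1)))) => //.
    apply: pair_cts; first exact: cfst.
    apply: comp_cts; last exact: uclamp_continuous.
    exact: affine_cts.
  + move=> a ->; rewrite uclamp_ge1 ?uclamp_le0 ?H1 ?K0//; lra.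
- by move=> t /=; rewrite uival0 invr_ge0 ler0n mulr0 uclamp_le0.
- move=> t /=; rewrite uival1 ifF; last by apply/negbTE; rewrite -ltNge; lra.
  by rewrite uclamp_ge1//; lra.
- by move=> s /=; case: ifP.
- by move=> s /=; case: ifP.
Qed.

Lemma path_homotopy_concat x y z (p p' : {path I from x to y})
    (q q' : {path I from y to z}) :
  path_homotopy p p' -> path_homotopy q q' ->
  path_homotopy (path_concat p q) (path_concat p' q').
Proof.
move=> [H [cH H0 H1 Hx Hy]] [K [cK K0 K1 Kx Ky]].
have cs : continuous (fun a : I * I => uival a.1).
  by apply: comp_cts; [exact: cfst|exact: uival_continuous].
exists (fun a => if uival a.1 <= 2^-1 then H (uclamp (2 * uival a.1), a.2)
                 else K (uclamp (2 * uival a.1 - 1), a.2)); split.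
- apply: (@pasting_continuous R) => //.
  + apply: (comp_cts (f := fun a : I * I => (uclamp (2 * uival a.1), a.2))) => //.
    apply: pair_cts; last exact: csnd.
    apply: comp_cts; last exact: uclamp_continuous.
    under eq_fun do rewrite -[2 * _]addr0.
    exact: affine_cts.
  + apply: (comp_cts
      (f := fun a : I * I => (uclamp (2 * uival a.1 - 1), a.2))) => //.
    apply: pair_cts; last exact: csnd.
    apply: comp_cts; last exact: uclamp_continuous.
    exact: affine_cts.
  + move=> a ->; rewrite uclamp_ge1 ?uclamp_le0 ?Hy ?Kx//; lra.
- by move=> t /=; rewrite /path_concat_fun /mk_path H0 K0.
- by move=> t /=; rewrite /path_concat_fun /mk_path H1 K1.
- by move=> s /=; rewrite uival0 invr_ge0 ler0n mulr0 uclamp_le0.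
- move=> s /=; rewrite uival1 ifF; last by apply/negbTE; rewrite -ltNge; lra.
  by rewrite uclamp_ge1//; lra.
Qed.

Lemma path_homotopy_rev x y (p q : {path I from x to y}) :
  path_homotopy p q -> path_homotopy (path_rev p) (path_rev q).
Proof.
move=> [H [cH H0 H1 Hx Hy]].
exists (fun a => H (uclamp (1 - uival a.1), a.2)); split => //=.
- apply: (comp_cts (f := fun a : I * I => (uclamp (1 - uival a.1), a.2))) => //.
  apply: pair_cts; last exact: csnd.
  apply: comp_cts; last exact: uclamp_continuous.
  under eq_fun do rewrite addrC -mulN1r.
  by apply: affine_cts; apply: comp_cts; [exact: cfst|exact: uival_continuous].
- by move=> t; rewrite /mk_path H0.
- by move=> t; rewrite /mk_path H1.
- by move=> s; rewrite uival0 subr0 uclamp_ge1.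
- by move=> s; rewrite uival1 subrr uclamp_le0.
Qed.

Let idmap_cts : continuous (fun v : R => v).
Proof. by move=> v; exact: cvg_id. Qed.

Let lin_cts (a b : R) : continuous (fun v => a * v + b).
Proof. exact: affine_cts idmap_cts. Qed.

Let min_cts (f g : R -> R) : continuous f -> continuous g ->
  continuous (fun v => Num.min (f v) (g v)).
Proof. by move=> cf cg; exact: (@min_fun_continuous _ R R). Qed.

Let max_cts (f g : R -> R) : continuous f -> continuous g ->
  continuous (fun v => Num.max (f v) (g v)).
Proof. by move=> cf cg; exact: (@max_fun_continuous _ R R). Qed.

Lemma path_concatA x y z w (p : {path I from x to y})
    (q : {path I from y to z}) (r : {path I from z to w}) :
  path_homotopy (path_concat p (path_concat q r))
                (path_concat (path_concat p q) r).
Proof.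
pose g (v : R) := Num.min (2 * v + 0) (Num.min (1 * v + 4^-1) (2^-1 * v + 2^-1)).
have gE1 v : v <= 4^-1 -> g v = 2 * v.
  by move=> v1; rewrite /g min_l ?addr0// le_min; apply/andP; split; lra.
have gE2 v : 4^-1 <= v <= 2^-1 -> g v = v + 4^-1.
  move=> /andP[v1 v2].
  have m : Num.min (1 * v + 4^-1) (2^-1 * v + 2^-1) = v + 4^-1.
    by rewrite min_l; lra.
  by rewrite /g m min_r//; lra.
have gE3 v : 2^-1 <= v -> g v = 2^-1 * v + 2^-1.
  move=> v1.
  have m : Num.min (1 * v + 4^-1) (2^-1 * v + 2^-1) = 2^-1 * v + 2^-1.
    by rewrite min_r; lra.
  by rewrite /g m min_r//; lra.
apply: (@path_homotopy_reparam _ _ (path_concat p (path_concat q r)) _ _ id g).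
- exact: idmap_cts.
- by apply: min_cts; [|apply: min_cts]; exact: lin_cts.
- by move=> t; rewrite uclampK.
- move=> t; have /andP[t0 t1] := uival_itv t.
  have [t4|t4] := leP (uival t) 4^-1.
    have e : uival (uclamp (2 * uival t)) = 2 * uival t by rewrite uclamp_id; lra.
    rewrite gE1// path_concat_left; last lra.
    rewrite path_concat_left ?e; last lra.
    by rewrite path_concat_left ?e//; lra.
  have [t2|t2] := leP (uival t) 2^-1.
    have e : uival (uclamp (2 * uival t)) = 2 * uival t by rewrite uclamp_id; lra.
    have e' : uival (uclamp (uival t + 4^-1)) = uival t + 4^-1.
      by rewrite uclamp_id; lra.
    have e'' : uival (uclamp (2 * (uival t + 4^-1) - 1)) =
        2 * (uival t + 4^-1) - 1 by rewrite uclamp_id; lra.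
    rewrite gE2; last lra.
    rewrite path_concat_left; last lra.
    rewrite path_concat_right ?e; last lra.
    rewrite path_concat_right ?e'; last lra.
    rewrite path_concat_left ?e''; last lra.
    by congr (q (uclamp _)); lra.
  have e : uival (uclamp (2^-1 * uival t + 2^-1)) = 2^-1 * uival t + 2^-1.
    by rewrite uclamp_id; lra.
  have e' : uival (uclamp (2 * (2^-1 * uival t + 2^-1) - 1)) =
      2 * (2^-1 * uival t + 2^-1) - 1 by rewrite uclamp_id; lra.
  rewrite gE3; last lra.
  rewrite path_concat_right; last lra.
  rewrite path_concat_right ?e; last lra.
  rewrite path_concat_right ?e'; last lra.
  by congr (r (uclamp _)); lra.
- by [].
- by rewrite gE1; lra.
- by [].
- by rewrite gE3; lra.
Qed.

Lemma path_const_concat x y (p : {path I from x to y}) :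
  path_homotopy (path_concat (path_const x) p) p.
Proof.
apply: (@path_homotopy_reparam _ _ p _ _
  (fun v => Num.max (0 * v + 0) (2 * v + -1)) id).
- by apply: max_cts; exact: lin_cts.
- exact: idmap_cts.
- move=> t; have /andP[t0 t1] := uival_itv t.
  rewrite /= /mk_path /path_concat_fun /=.
  rewrite mul0r addr0.
  case: leP => t2; first by rewrite uclamp_le0 ?path_zero// ge_max; lra.
  by congr (p (uclamp _)); rewrite max_r//; lra.
- by move=> t; rewrite uclampK.
- by rewrite ge_max; lra.
- by [].
- by rewrite le_max; lra.
- by [].
Qed.

Lemma path_concat_const x y (p : {path I from x to y}) :
  path_homotopy (path_concat p (path_const y)) p.
Proof.
apply: (@path_homotopy_reparam _ _ p _ _ (fun v => 2 * v + 0) id).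
- exact: lin_cts.
- exact: idmap_cts.
- move=> t; have /andP[t0 t1] := uival_itv t.
  rewrite /= /mk_path /path_concat_fun /= addr0.
  by case: leP => t2 //; rewrite uclamp_ge1 ?path_one//; lra.
- by move=> t; rewrite uclampK.
- by rewrite mulr0 addr0.
- by [].
- by lra.
- by [].
Qed.

Lemma path_homotopy_loop x y (r : {path I from x to y})
    (p : {path I from x to x}) (f : R -> R) :
  continuous f -> (forall t, p t = r (uclamp (f (uival t)))) ->
  f 0 <= 0 -> f 1 <= 0 -> path_homotopy p (path_const x).
Proof.
move=> cf pE f0 f1.
pose h (a : I * I) := (1 - uival a.2) * f (uival a.1).
exists (fun a => r (uclamp (h a))); split.
- apply: comp_cts; last exact: cts_fun.
  apply: comp_cts; last exact: uclamp_continuous.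
  have c1 : continuous (fun a : I * I => uival a.1).
    by apply: comp_cts; [exact: cfst|exact: uival_continuous].
  have c2 : continuous (fun a : I * I => uival a.2).
    by apply: comp_cts; [exact: csnd|exact: uival_continuous].
  have cf' := comp_cts c1 cf.
  move=> a; apply: cvgM; last exact: cf'.
  by apply: (@cvgB _ R^o); [exact: cvg_cst|exact: c2].
- by move=> t; rewrite pE /h /= uival0 subr0 mul1r.
- by move=> t; rewrite /h /= uival1 subrr mul0r uclamp_le0// path_zero.
- move=> s; rewrite /h /= uival0 uclamp_le0 ?path_zero//.
  by have /andP[] := uival_itv s; nra.
- move=> s; rewrite /h /= uival1 uclamp_le0 ?path_zero//.
  by have /andP[] := uival_itv s; nra.
Qed.

Lemma path_concat_rev x y (p : {path I from x to y}) :
  path_homotopy (path_concat p (path_rev p)) (path_const x).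
Proof.
apply: (@path_homotopy_loop _ _ p _
  (fun v => Num.min (2 * v + 0) ((-2) * v + 2))).
- by apply: min_cts; exact: lin_cts.
- move=> t; have /andP[t0 t1] := uival_itv t.
  rewrite /= /mk_path /path_concat_fun.
  rewrite /= /mk_path /path_rev_fun addr0.
  case: leP => t2; first by rewrite min_l//; lra.
  rewrite uclamp_id; last lra.
  by congr (p (uclamp _)); rewrite min_r; lra.
- by rewrite ge_min; lra.
- by rewrite ge_min; lra.
Qed.

Lemma path_rev_concat x y (p : {path I from x to y}) :
  path_homotopy (path_concat (path_rev p) p) (path_const y).
Proof.
apply: (@path_homotopy_loop _ _ (path_rev p) _
  (fun v => Num.min (2 * v + 0) ((-2) * v + 2))).
- by apply: min_cts; exact: lin_cts.
- move=> t; have /andP[t0 t1] := uival_itv t.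
  rewrite /= /mk_path /path_concat_fun.
  rewrite /= /mk_path /path_rev_fun addr0.
  case: leP => t2; first by rewrite min_l//; lra.
  rewrite min_r; last lra.
  rewrite uclamp_id; last lra.
  by congr (p (uclamp _)); lra.
- by rewrite ge_min; lra.
- by rewrite ge_min; lra.
Qed.

End Homotopy.

Section FundamentalGroup.
Variables (R : realType) (X : topologicalType) (x : X).
Local Notation I := (unit_interval R).

Definition loop_homotopic (p q : {path I from x to x}) : bool :=
  `[< path_homotopy p q >].

Lemma loop_homotopic_refl : reflexive loop_homotopic.
Proof. by move=> p; apply/asboolP; exact: path_homotopy_refl. Qed.

Lemma loop_homotopic_sym : symmetric loop_homotopic.
Proof.
by move=> p q; apply/asboolP/asboolP; exact: path_homotopy_sym.
Qed.

Lemma loop_homotopic_trans : transitive loop_homotopic.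
Proof.
move=> q p r /asboolP pq /asboolP qr; apply/asboolP.
exact: path_homotopy_trans pq qr.
Qed.

Canonical loop_homotopic_equiv := EquivRel loop_homotopic
  loop_homotopic_refl loop_homotopic_sym loop_homotopic_trans.

(* The fundamental group of X at the base point x. *)
Definition pi1 : Type := {eq_quot loop_homotopic_equiv}.

HB.instance Definition _ := Choice.copy pi1 {eq_quot loop_homotopic_equiv}.

Definition loop_class (p : {path I from x to x}) : pi1 :=
  \pi_{eq_quot loop_homotopic_equiv} p.

Lemma loop_classP (p q : {path I from x to x}) :
  loop_class p = loop_class q <-> path_homotopy p q.
Proof.
by split => [/eqmodP/asboolP|h]; last exact/eqmodP/asboolP.
Qed.

Lemma pi1P (P : pi1 -> Prop) :
  (forall p, P (loop_class p)) -> forall u, P u.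
Proof.
by move=> H u; rewrite -[u](@reprK _ {eq_quot loop_homotopic_equiv}).
Qed.

Definition pi1_repr (u : pi1) : {path I from x to x} :=
  repr (u : {eq_quot loop_homotopic_equiv}).

Lemma pi1_reprK u : loop_class (pi1_repr u) = u.
Proof. exact: reprK. Qed.

Definition pi1_one : pi1 := loop_class (path_const R x).

Definition pi1_inv (u : pi1) : pi1 := loop_class (path_rev (pi1_repr u)).

Definition pi1_mul (u v : pi1) : pi1 :=
  loop_class (path_concat (pi1_repr u) (pi1_repr v)).

Lemma loop_class_concat p q :
  loop_class (path_concat p q) = pi1_mul (loop_class p) (loop_class q).
Proof.
by apply/loop_classP/path_homotopy_concat; apply/loop_classP;
  rewrite pi1_reprK.
Qed.

Lemma loop_class_rev p : loop_class (path_rev p) = pi1_inv (loop_class p).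
Proof.
by apply/loop_classP/path_homotopy_rev/loop_classP; rewrite pi1_reprK.
Qed.

Lemma pi1_mulA : associative pi1_mul.
Proof.
elim/pi1P => p; elim/pi1P => q; elim/pi1P => r.
by rewrite -!loop_class_concat; apply/loop_classP/path_concatA.
Qed.

Lemma pi1_mul1g : left_id pi1_one pi1_mul.
Proof.
elim/pi1P => p; rewrite -!loop_class_concat.
exact/loop_classP/path_const_concat.
Qed.

Lemma pi1_mulg1 : right_id pi1_one pi1_mul.
Proof.
elim/pi1P => p; rewrite -!loop_class_concat.
exact/loop_classP/path_concat_const.
Qed.

Lemma pi1_mulVg : left_inverse pi1_one pi1_inv pi1_mul.
Proof.
elim/pi1P => p; rewrite -loop_class_rev -loop_class_concat.
exact/loop_classP/path_rev_concat.
Qed.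

Lemma pi1_mulgV : right_inverse pi1_one pi1_inv pi1_mul.
Proof.
elim/pi1P => p; rewrite -loop_class_rev -loop_class_concat.
exact/loop_classP/path_concat_rev.
Qed.

HB.instance Definition _ := isGroup.Build pi1
  pi1_mulA pi1_mul1g pi1_mulg1 pi1_mulVg pi1_mulgV.

End FundamentalGroup.

(* Main.v *)
Require Import Defs.
From HB Require Import structures.
From mathcomp Require Import all_boot all_order all_algebra generic_quotient.
From mathcomp Require Import all_classical all_reals all_analysis homotopy.
From mathcomp Require Import lra zify.
Import Order.TTheory GRing.Theory Num.Theory.
Import numFieldNormedType.Exports.

Set Implicit Arguments.
Unset Strict Implicit.
Unset Printing Implicit Defensive.

Local Open Scope classical_set_scope.
Local Open Scope ring_scope.

(** Sigma is simply connected, and it is the universal cover of SigmaQ with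
    deck group cyclic of order n.

    The deck group is generated by the shift a_i -> a_(i+1),
    a'_i -> a'_(i+2), b'_i -> b'_(i+2), b_(i,j) -> b_(i+1,j+2),
    c_(i,j) -> c_(i+1,j+2).  It preserves the minimal open sets U_x, its orbits
    are the classes of the equivalence relation ([deck_sim], [sim_deck]), and
    the shifts by k and by l agree at a point only if k = l mod n ([deck_eq]).
    Two distinct equivalent points never lie in a common U_x, and never have
    minimal open sets that meet ([Sigma_sim_inj], [Sigma_sim_sep]), so the
    projection is a covering ([Sigma_covering]).

    For simple connectivity, any two paths with the same ends inside one U_m
    are homotopic, since m is the apex of a cone ([min_nbhs_path_homotopy]), and
    every path is, up to homotopy, a finite concatenation of such small paths
    ([path_local_induction]).  Hence it is enough to choose for each point x a
    path from a base point to x, compatibly, up to homotopy, with going down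
    from x to any y in U_x ([flat_section_homotopy]).  Such a choice exists
    ([Sigma_flat_section]): each B_i with C_i is a circle, A' with B' is another
    one onto which all of these are collapsed by parallel identifications, and
    U_(a_i) is a cone over the i-th circle.  One such cone already makes every
    loop around any of the circles trivial; the other cones are attached along
    connected sets and create no new loops.

    Lifting paths ([path_lifting]) and homotopies ([lift_homotopy_endpoint]),
    the class of a loop at x is determined by the end of its lift from a point
    e over x, and that end is an arbitrary point of the orbit of e.  Sending k
    to the class of the image of a path from e to its shift by k is therefore
    a bijection from the integers mod n, and a morphism because shifting a
    path does not change its image ([deck_classD]). *)

(** * Induction along the unit interval *)

Section IntervalInduction.
Variable R : realType.
Local Notation I := (unit_interval R).

(** Connectedness of the interval: the hypothesis says that both J and its
    complement are open.  It replaces every appeal to a Lebesgue number. *)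
Lemma unit_interval_induction (J : set I) :
  J zero ->
  (forall t0 : I, exists2 V : set I, nbhs t0 V &
    forall t1 t2, V t1 -> V t2 -> J t1 -> J t2) ->
  forall t, J t.
Proof.
(* J is carried to the line, whose connectedness is available, along the
   retraction uclamp. *)
move=> J0 Jloc t; pose K := [set r : R | J (uclamp r)].
have near_K (r0 : R) : exists2 W : set R, nbhs r0 W &
    forall r1 r2, W r1 -> W r2 -> K r1 -> K r2.
  have [V V0 VJ] := Jloc (uclamp r0).
  exists (@uclamp R @^-1` V); first exact: uclamp_continuous V0.
  by move=> r1 r2 /VJ h /h; exact.
have oK : open K.
  rewrite openE => r0 Kr0; have [W W0 WK] := near_K r0.
  by apply: filterS (W0) => r Wr; apply: WK Kr0 => //; exact: nbhs_singleton W0.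
have cK : closed K.
  rewrite -[K]setCK; apply: open_closedC; rewrite openE => r0 nKr0.
  have [W W0 WK] := near_K r0; apply: filterS (W0) => r Wr Kr; apply: nKr0.
  by apply: WK Kr => //; exact: nbhs_singleton W0.
have cR : connected [set: R].
  by apply/connected_intervalP => ? ? _ _ ? _.
suff KT : K = setT by rewrite -[t]uclampK; have : K (uival t) by rewrite KT.
apply: cR; [|by exists K; rewrite ?setTI..].
by exists 0; rewrite /K /= uclamp_le0.
Qed.

Lemma unit_interval_nbhs_ball (t0 : I) (A : set I) : nbhs t0 A ->
  exists2 e : R, 0 < e & forall t, `|uival t - uival t0| < e -> A t.
Proof.
move=> At0; have /(_ A) := @uclamp_continuous R (uival t0).
rewrite uclampK => /(_ At0) /nbhs_ballP[e e0 eA]; exists e => // t te.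
by rewrite -[t]uclampK; apply: eA; rewrite /ball /= distrC.
Qed.

Lemma unit_interval_ball_nbhs (t0 : I) (e : R) : 0 < e ->
  nbhs t0 [set t : I | `|uival t - uival t0| < e].
Proof.
move=> e0; have h : nbhs t0 (@uival R @^-1` ball (uival t0) e).
  exact: (@uival_continuous R t0 _ (nbhsx_ballx (uival t0) e e0)).
apply: filterS h => t /=; by rewrite /ball /= distrC.
Qed.

(** The affine parametrization of the segment from s to t. *)
Definition seg (s t : I) (u : I) : I :=
  uclamp (uival s + uival u * (uival t - uival s)).

Lemma seg_val s t u : uival (seg s t u) = uival s + uival u * (uival t - uival s).
Proof.
have /andP[? ?] := uival_itv s; have /andP[? ?] := uival_itv t.
by have /andP[? ?] := uival_itv u; apply: uclamp_id; nra.
Qed.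

Lemma seg0 s t : seg s t zero = s.
Proof. by apply: uival_inj; rewrite seg_val uival0 mul0r addr0. Qed.

Lemma seg1 s t : seg s t one = t.
Proof. by apply: uival_inj; rewrite seg_val uival1 mul1r addrC subrK. Qed.

Lemma seg_ball s t u (t0 : I) e :
  `|uival s - uival t0| < e -> `|uival t - uival t0| < e ->
  `|uival (seg s t u) - uival t0| < e.
Proof.
rewrite seg_val !ltr_norml => /andP[? ?] /andP[? ?].
have /andP[u0 u1] := uival_itv u.
have [st|ts] := leP (uival s) (uival t).
  have l : uival s <= uival s + uival u * (uival t - uival s) by nra.
  have r : uival s + uival u * (uival t - uival s) <= uival t by nra.
  by lra.
have l : uival t <= uival s + uival u * (uival t - uival s) by nra.
have r : uival s + uival u * (uival t - uival s) <= uival s by nra.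
by lra.
Qed.

Lemma affine_continuous (Y : topologicalType) (f : Y -> R) (a b : R) :
  continuous f -> continuous (fun y => a + f y * b).
Proof.
move=> cf y; apply: (@cvgD _ R^o); first exact: cvg_cst.
by apply: cvgM; [exact: cf|exact: cvg_cst].
Qed.

Lemma seg_continuous s t : continuous (seg s t).
Proof.
move=> u; apply: (continuous_comp
    (f := fun u => uival s + uival u * (uival t - uival s))).
  by apply: affine_continuous; exact: uival_continuous.
exact: uclamp_continuous.
Qed.

End IntervalInduction.

(** * Subpaths *)

Section PathTools.
Variables (R : realType) (X : topologicalType).
Local Notation I := (unit_interval R).

Lemma cts_comp (A B C : topologicalType) (f : A -> B) (g : B -> C) :
  continuous f -> continuous g -> continuous (fun a => g (f a)).
Proof. by move=> cf cg a; apply: continuous_comp; [exact: cf|exact: cg]. Qed.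

Arguments cts_comp {A B C f g}.

Lemma fst_continuous (A B : topologicalType) : continuous (fun a : A * B => a.1).
Proof. by move=> ?; exact: cvg_fst. Qed.

Lemma snd_continuous (A B : topologicalType) : continuous (fun a : A * B => a.2).
Proof. by move=> ?; exact: cvg_snd. Qed.

Definition to_path (x y : X) (f : I -> X) (cf : continuous f)
    (f0 : f zero = x) (f1 : f one = y) : {path I from x to y} :=
  mk_path cf f0 f1.

Lemma to_pathE x y f cf f0 f1 t : @to_path x y f cf f0 f1 t = f t.
Proof. by []. Qed.

(** The straight-line homotopy from f to g, followed by phi.  The line, and not
    the interval, is the domain of phi so that no bounds on f and g have to be
    carried along; only their ends must agree. *)
Lemma path_homotopy_line x y (phi : R -> X) (f g : I -> R)
    (p q : {path I from x to y}) :
  continuous phi -> continuous f -> continuous g ->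
  f zero = g zero -> f one = g one ->
  (forall t, p t = phi (f t)) -> (forall t, q t = phi (g t)) ->
  path_homotopy p q.
Proof.
move=> cphi cf cg fg0 fg1 pE qE.
pose h (a : I * I) := f a.1 + uival a.2 * (g a.1 - f a.1).
exists (fun a => phi (h a)); split.
- apply: cts_comp cphi.
  have c1 := cts_comp (@fst_continuous I I) cf.
  have c2 := cts_comp (@fst_continuous I I) cg.
  have c3 := cts_comp (@snd_continuous I I) (@uival_continuous R).
  move=> a; apply: (@cvgD _ R^o); first exact: c1.
  apply: cvgM; first exact: c3.
  by apply: (@cvgB _ R^o); [exact: c2|exact: c1].
- by move=> t; rewrite /h /= uival0 mul0r addr0.
- by move=> t; rewrite /h /= uival1 mul1r addrC subrK.
- by move=> s; rewrite /h /= fg0 subrr mulr0 addr0 -fg0 -pE path_zero.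
- by move=> s; rewrite /h /= fg1 subrr mulr0 addr0 -fg1 -pE path_one.
Qed.

Definition subpath (x y : X) (p : {path I from x to y}) (s t : I) :
    {path I from p s to p t} :=
  to_path (cts_comp (@seg_continuous R s t) (@cts_fun _ _ p))
    (congr1 p (seg0 s t)) (congr1 p (seg1 s t)).

Lemma subpath_concat (x y : X) (p : {path I from x to y}) (r s t : I) :
  path_homotopy (path_concat (subpath p r s) (subpath p s t)) (subpath p r t).
Proof.
pose f (u : I) := if uival u <= 2^-1
  then uival r + (2 * uival u) * (uival s - uival r)
  else uival s + (2 * uival u - 1) * (uival t - uival s).
pose g (u : I) := uival r + uival u * (uival t - uival r).
have c2 (b : R) : continuous (fun u : I => 2 * uival u + b).
  under eq_fun do rewrite addrC mulrC.
  by apply: affine_continuous; exact: uival_continuous.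
apply: (@path_homotopy_line _ _ (fun v => p (uclamp v)) f g).
- exact: (cts_comp (@uclamp_continuous R) (@cts_fun _ _ p)).
- apply: (@pasting_continuous R); first exact: uival_continuous.
  + apply: affine_continuous; under eq_fun do rewrite -[2 * _]addr0; exact: c2.
  + by apply: affine_continuous; exact: c2.
  + by move=> u ->; lra.
- by apply: affine_continuous; exact: uival_continuous.
- by rewrite /f /g uival0 invr_ge0 ler0n mulr0 !mul0r.
- rewrite /f /g uival1 ifF; first lra.
  by apply/negbTE; rewrite -ltNge; lra.
- move=> u; rewrite /f; have /andP[u0 u1] := uival_itv u.
  case: (leP (uival u) 2^-1) => u2.
    by rewrite path_concat_left// to_pathE /seg uclamp_id//; lra.
  by rewrite path_concat_right// to_pathE /seg uclamp_id//; lra.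
- by move=> u.
Qed.

End PathTools.

Arguments cts_comp {A B C f g}.

Section LocalInduction.
Variables (R : realType) (X : topologicalType).
Local Notation I := (unit_interval R).
Variable Q : forall x y : X, {path I from x to y} -> Prop.

(** The two paths have the same ends only up to propositional equality. *)
Let Q_transport (x x' y y' : X) (p : {path I from x to y})
    (p' : {path I from x' to y'}) : p =1 p' -> Q p -> Q p'.
Proof.
move=> pp'.
have ex : x = x' by rewrite -[LHS](@path_zero _ _ _ _ p) pp' path_zero.
have ey : y = y' by rewrite -[LHS](@path_one _ _ _ _ p) pp' path_one.
by subst x' y'; have -> : p = p' by exact/path_eqP.
Qed.

(** Up to homotopy, every path is a finite concatenation of small ones: the set of
    t such that Q holds of the part of p up to t is the whole interval by
    [unit_interval_induction], because two nearby parts differ by a small path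
    ([subpath_concat]). *)
Lemma path_local_induction :
  (forall x y (p p' : {path I from x to y}), path_homotopy p p' -> Q p -> Q p') ->
  (forall x y z (p : {path I from x to y}) (p' : {path I from y to z}),
    Q p -> Q p' -> Q (path_concat p p')) ->
  (forall z : X, exists2 N : set X, nbhs z N &
    forall x y (p : {path I from x to y}), (forall t, N (p t)) -> Q p) ->
  forall x y (p : {path I from x to y}), Q p.
Proof.
move=> Qh Qc Ql x y p.
have Qball (t0 : I) : exists2 V : set I, nbhs t0 V &
    forall t1 t2, V t1 -> V t2 -> Q (subpath p t1 t2).
  have [N N0 QN] := Ql (p t0).
  have /unit_interval_nbhs_ball[e e0 eN] : nbhs t0 (p @^-1` N).
    exact: (@cts_fun _ _ p).
  exists [set t : I | `|uival t - uival t0| < e].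
    exact: unit_interval_ball_nbhs.
  by move=> t1 t2 V1 V2; apply: QN => u; apply: eN; exact: seg_ball.
suff : Q (subpath p zero one) by apply: Q_transport => u;
  rewrite to_pathE /seg uival0 uival1 subr0 mulr1 add0r uclampK.
apply: (@unit_interval_induction _ [set t | Q (subpath p zero t)]) => [|t0].
  have [V V0 QV] := Qball zero; apply: QV; exact: nbhs_singleton V0.
have [V V0 QV] := Qball t0; exists V => // t1 t2 V1 V2 Q1.
by apply: (Qh _ _ _ _ (subpath_concat p zero t1 t2)); apply: Qc Q1 _; exact: QV.
Qed.

End LocalInduction.

(** * Spaces in which every point has a minimal neighbourhood *)

Section MinimalNbhs.
Variables (E : topologicalType) (U : E -> set E).
Hypothesis nbhsU : forall e A, nbhs e A <-> U e `<=` A.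

Lemma min_nbhs_refl e : U e e.
Proof. by apply: nbhs_singleton; apply/nbhsU. Qed.

Lemma min_nbhs_trans e z : U e z -> U z `<=` U e.
Proof.
have /nbhs_interior /nbhsU h : nbhs e (U e) by apply/nbhsU.
by move=> /h; rewrite /interior => /nbhsU.
Qed.

Lemma min_nbhs_continuous (Y : topologicalType) (f : Y -> E) :
  continuous f <-> forall y, \forall z \near y, U (f y) (f z).
Proof.
split=> [cf y|h y A /nbhsU UA]; first by apply: cf; apply/nbhsU.
by apply: filterS (h y) => z; exact: UA.
Qed.

(** In U m, a neighbourhood of m contains everything, so a map into U m may be
    replaced by the constant m on any closed set. *)
Lemma cone_continuous (Y : topologicalType) (m : E) (C : set Y) (f : Y -> E) :
  closed C -> continuous f -> (forall y, U m (f y)) ->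
  continuous (fun y => if `[< C y >] then m else f y).
Proof.
move=> cC cf Uf; apply/min_nbhs_continuous => y.
case: asboolP => [_|nCy].
  by near=> z; case: ifP => _ //; exact: min_nbhs_refl.
have nC : nbhs y (~` C).
  by apply: open_nbhs_nbhs; split=> //; exact: closed_openC.
have fy := (min_nbhs_continuous f).1 cf y.
by near=> z; rewrite ifF; [near: z|apply/asboolPn; near: z].
Unshelve. all: by end_near.
Qed.

Variable R : realType.
Local Notation I := (unit_interval R).

Lemma uival_preimage_closed (Y : topologicalType) (f : Y -> I) (a b : R) :
  continuous f -> closed [set y | a <= uival (f y) <= b].
Proof.
move=> cf; rewrite (_ : mkset _ = (fun y => uival (f y)) @^-1` `[a, b]).
  apply: closed_comp; last exact: interval_closed.
  by move=> y _; exact: (cts_comp cf (@uival_continuous R)).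
by apply/seteqP; split=> y /=; rewrite in_itv.
Qed.

Let third0 : (3^-1 <= 0 :> R) = false. Proof. lra. Qed.
Let third1 : (1 <= 2 * 3^-1 :> R) = false. Proof. lra. Qed.
Let half0 : (2^-1 <= 0 :> R) = false. Proof. lra. Qed.
Let half1 : (1 <= 2^-1 :> R) = false. Proof. lra. Qed.
Let half_lt1 : (2^-1 < 1 :> R). Proof. lra. Qed.
Let three_ge1 : (1 <= 3 * 1 + -1 :> R). Proof. lra. Qed.

Let third (u : I) : I := uclamp (3 * uival u + -1).

Let third_cts : continuous third.
Proof.
apply: cts_comp (@uclamp_continuous R).
under eq_fun do rewrite addrC mulrC.
by apply: affine_continuous; exact: uival_continuous.
Qed.

(** U m is contractible onto its apex m.  Rather than contracting, both paths are
    deformed into the same path, which stays at x, then at m, then at y: after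
    compressing p into the middle third, so that it rests at its ends outside, the
    homotopy jumps to m over the middle third, as [cone_continuous] permits. *)
Lemma min_nbhs_path_homotopy (m x y : E) (p p' : {path I from x to y}) :
  (forall t, U m (p t)) -> (forall t, U m (p' t)) -> path_homotopy p p'.
Proof.
pose K (r : {path I from x to y}) (u : I) :=
  if `[< [set u : I | 3^-1 <= uival u <= 2 * 3^-1] u >] then m else r (third u).
suff detour (r : {path I from x to y}) : (forall t, U m (r t)) ->
    exists2 d : {path I from x to y}, d =1 K r & path_homotopy r d.
  move=> Up Up'; have [d dE pd] := detour _ Up.
  have [d' dE' pd'] := detour _ Up'.
  apply: path_homotopy_trans pd _; apply: path_homotopy_sym.
  have -> // : d = d'; apply/path_eqP => u; rewrite dE dE' /K.
  case: asboolP => // /negP; rewrite /= negb_and -!ltNge => /orP[] h.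
    by rewrite /third uclamp_le0 ?path_zero//; lra.
  by rewrite /third uclamp_ge1 ?path_one//; lra.
move=> Ur.
have cr : continuous (fun u => r (third u)).
  exact: (cts_comp third_cts (@cts_fun _ _ r)).
have r0 : r (third zero) = x by rewrite /third uival0 uclamp_le0 ?path_zero//; lra.
have r1 : r (third one) = y by rewrite /third uival1 uclamp_ge1 ?path_one//; lra.
have cK : continuous (K r).
  apply: cone_continuous => //.
  by apply: (uival_preimage_closed (f := fun u => u)) => u; exact: cvg_id.
have K0 : K r zero = x.
  rewrite /K; case: asboolP => // /=.
  by rewrite uival0 third0.
have K1 : K r one = y.
  rewrite /K; case: asboolP => // /=.
  by rewrite uival1 third1 andbF.
exists (to_path cK K0 K1) => //.
apply: (@path_homotopy_trans _ _ _ _ (to_path cr r0 r1)).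
  apply: (@path_homotopy_reparam _ _ _ _ r _ _ id (fun v => 3 * v + -1)) => //.
  - by move=> v; exact: cvg_id.
  - under eq_fun do rewrite addrC mulrC.
    by apply: affine_continuous => v; exact: cvg_id.
  - by move=> t; rewrite uclampK.
pose C := [set a : I * I | 3^-1 <= uival a.1 <= 2 * 3^-1] `&`
          [set a : I * I | 2^-1 <= uival a.2 <= 1].
exists (fun a => if `[< C a >] then m else r (third a.1)); split.
- apply: cone_continuous => //.
    by apply: closedI; apply: uival_preimage_closed;
      [exact: fst_continuous|exact: snd_continuous].
  exact: (cts_comp (@fst_continuous I I) cr).
- by move=> t; case: asboolP => // -[_ /=]; rewrite uival0 half0.
- move=> t; rewrite to_pathE /K; congr (if _ then _ else _).
  apply/asboolP/asboolP => [[]//|h]; split => //=.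
  by rewrite uival1 lexx andbT ltW.
- by move=> ?; case: asboolP => // -[/= + _]; rewrite uival0 third0.
- by move=> ?; case: asboolP => // -[/= + _]; rewrite uival1 third1 andbF.
Qed.

(** The path rests at m up to time 1/2 and at z afterwards; it is continuous as the
    set of times where it is at m is closed. *)
Lemma min_nbhs_path (m z : E) : U m z ->
  exists p : {path I from m to z}, forall t, U m (p t).
Proof.
move=> Uz; pose C := [set u : I | 0 <= uival u <= 2^-1].
have cf : continuous (fun u : I => if `[< C u >] then m else z).
  apply: cone_continuous => //; last exact: cst_continuous.
  by apply: (uival_preimage_closed (f := fun u => u)) => u; exact: cvg_id.
have f0 : (if `[< C zero >] then m else z) = m.
  by rewrite asboolT// /C /= uival0; apply/andP; split; lra.
have f1 : (if `[< C one >] then m else z) = z.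
  by rewrite asboolF// /C /= uival1 half1 andbF.
exists (to_path cf f0 f1) => t; rewrite to_pathE; case: ifP => // _.
exact: min_nbhs_refl.
Qed.

End MinimalNbhs.

(** * Coverings of such spaces, and lifting *)

(** Covering maps between such spaces.  By [cov_open] and [cov_cts] the image of
    U e is the minimal neighbourhood of q e; by [cov_inj] the map q is injective
    on the sheet U e; and [cov_sep] and [cov_sheet] say that the preimage of
    that neighbourhood is the disjoint union of the sheets U e' with
    q e' = q e. *)
Record min_covering (E X : topologicalType) (U : E -> set E) (q : E -> X) :
    Prop := MinCovering {
  cov_nbhs : forall e A, nbhs e A <-> U e `<=` A;
  cov_cts : continuous q;
  cov_surj : forall x, exists e, q e = x;
  cov_open : forall e, nbhs (q e) (q @` U e);
  cov_inj : forall e z z', U e z -> U e z' -> q z = q z' -> z = z';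
  cov_sep : forall e e' z, U e z -> U e' z -> q e = q e' -> e = e';
  cov_sheet : forall e z w, U e w -> q z = q w ->
    exists2 e', q e' = q e & U e' z }.

Section Lifting.
Variables (R : realType) (E X : topologicalType) (U : E -> set E) (q : E -> X).
Hypothesis cov : min_covering U q.
Local Notation I := (unit_interval R).

Let nbhsU := cov_nbhs cov.

Let near_U (Y : topologicalType) (g : Y -> E) y :
  continuous g -> nbhs y [set z | U (g y) (g z)].
Proof. by move=> /(min_nbhs_continuous nbhsU); exact. Qed.

Lemma cov_image_sub e e' : q e = q e' -> q @` U e `<=` q @` U e'.
Proof.
move=> ee' _ [z ez <-].
have h : nbhs (q e) (q @` U e') by rewrite ee'; exact: (cov_open cov).
have : nbhs e (q @^-1` (q @` U e')) by exact: (cov_cts cov h).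
by move=> /nbhsU; exact.
Qed.

(** The section of q over a sheet is continuous. *)
Lemma sheet_continuous (Y : topologicalType) (h : Y -> E) e :
  (forall y, U e (h y)) -> continuous (q \o h) -> continuous h.
Proof.
move=> eh cqh; apply/(min_nbhs_continuous nbhsU) => y.
have near_qU : nbhs y [set z | (q @` U (h y)) (q (h z))].
  exact: (cqh y _ (cov_open cov (h y))).
apply: filterS near_qU => z [w hw qw].
suff -> : h z = w by [].
apply: (cov_inj cov (eh z)) => //.
exact: (min_nbhs_trans nbhsU (eh y)) hw.
Qed.

(** On a neighbourhood of t0 where f and g stay in the sheets of f t0 and g t0,
    they agree at one point only if these sheets coincide ([cov_sep]), and then
    they agree throughout ([cov_inj]). *)
Lemma lift_unique (f g : I -> E) : continuous f -> continuous g ->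
  (forall t, q (f t) = q (g t)) -> f zero = g zero -> forall t, f t = g t.
Proof.
move=> cf cg qfg fg0.
apply: (@unit_interval_induction _ [set t | f t = g t]) => // t0.
exists ([set t | U (f t0) (f t)] `&` [set t | U (g t0) (g t)]).
  by apply: filterI; exact: near_U.
move=> t1 t2 [/= f1 g1] [/= f2 g2] /= fg1; rewrite -fg1 in g1.
have e0 := cov_sep cov f1 g1 (qfg t0); rewrite -e0 in g2.
exact: (cov_inj cov f2 g2).
Qed.

(** The preimage of the image of U e is the disjoint union of open sheets, so a
    path in it does not leave its sheet. *)
Lemma lift_stays_in_sheet (g : I -> E) e : continuous g ->
  (forall t, (q @` U e) (q (g t))) -> U e (g zero) -> forall t, U e (g t).
Proof.
move=> cg qg g0.
apply: (@unit_interval_induction _ [set t | U e (g t)]) => // t0.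
exists [set t | U (g t0) (g t)]; first exact: near_U.
move=> t1 t2 /= g1 g2 eg1; have [w ew qw] := qg t0.
have [e' qe' e'g] := cov_sheet cov ew (esym qw).
have sub := min_nbhs_trans nbhsU e'g.
by rewrite (cov_sep cov eg1 (sub _ g1) (esym qe')); exact: sub.
Qed.

Let imin (t u : I) : I := if uival u <= uival t then u else t.
Let imax (t u : I) : I := if uival u <= uival t then t else u.

Let imin_cts t : continuous (imin t).
Proof.
apply: (@pasting_continuous R); first exact: uival_continuous.
- by move=> ?; exact: cvg_id.
- exact: cst_continuous.
- by move=> u /uival_inj.
Qed.

Let imax_cts t : continuous (imax t).
Proof.
apply: (@pasting_continuous R); first exact: uival_continuous.
- exact: cst_continuous.
- by move=> ?; exact: cvg_id.
- by move=> u /uival_inj.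
Qed.

Let imax_imin_ball (e : R) (t0 t1 t2 u : I) :
  `|uival t1 - uival t0| < e -> `|uival t2 - uival t0| < e ->
  `|uival (imax t1 (imin t2 u)) - uival t0| < e.
Proof.
rewrite !ltr_norml /imax /imin => /andP[? ?] /andP[? ?].
case: (leP (uival u) (uival t2)) => ?.
  by case: (leP (uival u) (uival t1)) => ?; lra.
by case: (leP (uival t2) (uival t1)) => ?; lra.
Qed.

(** By [unit_interval_induction] on the t such that the path stopped at time t
    lifts.  Near t0 the path stays in one evenly covered neighbourhood, so a lift
    up to t1 is either stopped earlier or prolonged inside a sheet. *)
Lemma path_lifting (p : I -> X) e : continuous p -> q e = p zero ->
  exists g : I -> E,
    [/\ continuous g, g zero = e & forall t, q (g t) = p t].
Proof.
move=> cp qe.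
pose J : set I := [set t | exists g : I -> E,
  [/\ continuous g, g zero = e & forall u, q (g u) = p (imin t u)]].
suff /(_ one)[g [cg g0 qg]] : forall t, J t.
  exists g; split=> // t; rewrite qg /imin ifT// uival1.
  by have /andP[] := uival_itv t.
apply: unit_interval_induction => [|t0].
  exists (cst e); split=> [||u] //; first exact: cst_continuous.
  rewrite /imin; case: ifP => // u0; rewrite qe; congr p; apply: uival_inj.
  by apply/eqP; rewrite eq_le u0 uival0; have /andP[->] := uival_itv u.
have [e' qe'] := cov_surj cov (p t0).
have pt0 : nbhs (p t0) (q @` U e') by rewrite -qe'; exact: (cov_open cov).
have /unit_interval_nbhs_ball[eps eps0 epsV] : nbhs t0 (p @^-1` (q @` U e')).
  exact: (cp _ _ pt0).
exists [set t : I | `|uival t - uival t0| < eps].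
  exact: unit_interval_ball_nbhs.
move=> t1 t2 V1 V2 [g [cg g0 qg]].
have [t21|t12] := leP (uival t2) (uival t1).
  exists (fun u => g (imin t2 u)); split.
  - exact: (cts_comp (@imin_cts t2) cg).
  - rewrite /imin ifT ?g0// uival0; by have /andP[] := uival_itv t2.
  - move=> u; rewrite qg; congr p; rewrite /imin.
    by case: (leP (uival u) (uival t2)) => ?; rewrite ifT//; lra.
have qg1 : q (g t1) = p t1 by rewrite qg /imin lexx.
have [w ew qw] : (q @` U e') (p t1) by exact: epsV.
(* The lift up to t1 ends in the sheet of some e0 over p t0, which need not be e'. *)
have [e0 qe0 eg1] : exists2 e0, q e0 = q e' & U e0 (g t1).
  by apply: (cov_sheet cov ew); rewrite qg1.
have /choice[h hP] : forall u, exists z,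
    U e0 z /\ q z = p (imax t1 (imin t2 u)).
  move=> u; have := epsV _ (imax_imin_ball u V1 V2).
  by move=> /(cov_image_sub (esym qe0))[z]; exists z.
have ch : continuous h.
  apply: (sheet_continuous (e := e0)) => [u|]; first by have [] := hP u.
  rewrite (_ : q \o h = p \o (imax t1 \o imin t2)); last first.
    by apply/funext => u /=; have [] := hP u.
  exact: (cts_comp (cts_comp (@imin_cts t2) (@imax_cts t1)) cp).
exists (fun u => if uival u <= uival t1 then g u else h u); split.
- apply: (@pasting_continuous R) => //; first exact: uival_continuous.
  move=> u /uival_inj ->; have [eh qh] := hP t1.
  apply: (cov_inj cov eg1 eh); rewrite qh qg1 /imin (ltW t12).
  by rewrite /imax lexx.
- by rewrite ifT ?g0// uival0; have /andP[] := uival_itv t1.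
- move=> u; case: leP => u1.
    by rewrite qg /imin u1 ifT//; lra.
  have [_ ->] := hP u; congr p; rewrite /imax /imin.
  by case: (leP (uival u) (uival t2)) => ?; rewrite ifF//; apply/negbTE;
    rewrite -ltNge.
Qed.

(** Let G s be the lift of the path H (-, s) from the common start of g and g'.
    It suffices that s -> G s 1 is continuous, for it is then a lift of the
    constant path at y, hence constant.  Continuity of s -> G s t at a fixed s0
    holds at t = 0 and propagates along the interval in t: around t0, by
    [lift_stays_in_sheet], all the G s with s close to s0 run in the same sheet
    as soon as they do so at one time t1. *)
Lemma lift_homotopy_endpoint (x y : X) (p p' : {path I from x to y})
    (g g' : I -> E) :
  path_homotopy p p' -> continuous g -> continuous g' ->
  (forall t, q (g t) = p t) -> (forall t, q (g' t) = p' t) ->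
  g zero = g' zero -> g one = g' one.
Proof.
move=> [H [cH H0 H1 Hx Hy]] cg cg' qg qg' gg'.
have cHs s : continuous (fun t => H (t, s)).
  apply: cts_comp cH; apply: pair_cts; last exact: cst_continuous.
  by move=> ?; exact: cvg_id.
have cHt t : continuous (fun s => H (t, s)).
  apply: cts_comp cH; apply: pair_cts; first exact: cst_continuous.
  by move=> ?; exact: cvg_id.
have /choice[G GP] s : exists G : I -> E,
    [/\ continuous G, G zero = g zero & forall t, q (G t) = H (t, s)].
  by apply: path_lifting; [exact: cHs|rewrite qg path_zero Hx].
have cG s : continuous (G s) by have [] := GP s.
have G0 s : G s zero = g zero by have [] := GP s.
have qG s t : q (G s t) = H (t, s) by have [] := GP s.
have gE : g one = G zero one.
  by apply: lift_unique => // t; rewrite qG H0.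
have gE' : g' one = G one one.
  by apply: lift_unique => // [t|]; [rewrite qG H1|rewrite G0].
rewrite gE gE'; symmetry.
pose Gend s := G s one.
suff cGend : continuous Gend.
  apply: (lift_unique (f := Gend) (g := fun=> G zero one)) => //.
    exact: cst_continuous.
  by move=> s; rewrite !qG !Hy.
apply/(min_nbhs_continuous nbhsU) => s0.
apply: (@unit_interval_induction _
    [set t | nbhs s0 [set s | U (G s0 t) (G s t)]]) => [|t0].
  near=> s; rewrite /= !G0; exact: (min_nbhs_refl nbhsU).
have qU0 : nbhs (H (t0, s0)) (q @` U (G s0 t0)).
  by rewrite -qG; exact: (cov_open cov).
have [[V W] /= [Vt0 Ws0] VW] := cH _ _ qU0.
have VU : nbhs t0 (V `&` [set t | U (G s0 t0) (G s0 t)]).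
  by apply: filterI Vt0 _; exact: near_U.
have [e e0 eV] := unit_interval_nbhs_ball VU.
exists [set t : I | `|uival t - uival t0| < e].
  exact: unit_interval_ball_nbhs.
move=> t1 t2 V1 V2 J1.
have [_ /= U1] := eV _ V1; have [_ /= U2] := eV _ V2.
have qU2 : nbhs (H (t2, s0)) (q @` U (G s0 t2)).
  by rewrite -qG; exact: (cov_open cov).
have {}qU2 : nbhs s0 [set s | (q @` U (G s0 t2)) (H (t2, s))].
  exact: (cHt t2 _ _ qU2).
rewrite /=; near=> s.
have Ws : W s by near: s.
have stay : U (G s0 t0) (G s t2).
  rewrite -(seg1 t1 t2).
  apply: (lift_stays_in_sheet (g := fun u => G s (seg t1 t2 u))).
  - exact: (cts_comp (@seg_continuous R t1 t2) (cG s)).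
  - move=> u; rewrite qG; apply: (VW (_, _)); split=> //=.
    by have [] := eV _ (seg_ball u V1 V2).
  - rewrite seg0; apply: (min_nbhs_trans nbhsU U1).
    by near: s.
have [z Uz qz] : (q @` U (G s0 t2)) (H (t2, s)) by near: s.
suff Gz : G s t2 = z by rewrite /= Gz.
apply: (cov_inj cov stay); last by rewrite qz qG.
exact: (min_nbhs_trans nbhsU U2).
Unshelve. all: by end_near.
Qed.

End Lifting.

(** * The groupoid of paths up to homotopy *)

Section PathAlgebra.
Variables (R : realType) (X : topologicalType).
Local Notation I := (unit_interval R).
Implicit Types x y z : X.

Lemma path_concat_homotopyl x y z (p p' : {path I from x to y})
    (r : {path I from y to z}) :
  path_homotopy p p' -> path_homotopy (path_concat p r) (path_concat p' r).
Proof. by move=> h; apply: path_homotopy_concat h _; exact: path_homotopy_refl. Qed.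

Lemma path_concat_homotopyr x y z (r : {path I from x to y})
    (p p' : {path I from y to z}) :
  path_homotopy p p' -> path_homotopy (path_concat r p) (path_concat r p').
Proof. by move=> h; apply: path_homotopy_concat _ h; exact: path_homotopy_refl. Qed.

Lemma path_concatK x y z (p : {path I from x to y}) (r : {path I from y to z}) :
  path_homotopy (path_concat (path_concat p r) (path_rev r)) p.
Proof.
apply: path_homotopy_trans (path_homotopy_sym (path_concatA _ _ _)) _.
apply: path_homotopy_trans (path_concat_const p).
exact/path_concat_homotopyr/path_concat_rev.
Qed.

Lemma path_concatVK x y z (p : {path I from x to y}) (r : {path I from z to y}) :
  path_homotopy (path_concat (path_concat p (path_rev r)) r) p.
Proof.
apply: path_homotopy_trans (path_homotopy_sym (path_concatA _ _ _)) _.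
apply: path_homotopy_trans (path_concat_const p).
exact/path_concat_homotopyr/path_rev_concat.
Qed.

Lemma path_concatKl x y z (r : {path I from x to y}) (p : {path I from y to z}) :
  path_homotopy (path_concat (path_rev r) (path_concat r p)) p.
Proof.
apply: path_homotopy_trans (path_concatA _ _ _) _.
apply: path_homotopy_trans (path_const_concat p).
exact/path_concat_homotopyl/path_rev_concat.
Qed.

Lemma path_concat_cancelr x y z (p p' : {path I from x to y})
    (r : {path I from y to z}) :
  path_homotopy (path_concat p r) (path_concat p' r) -> path_homotopy p p'.
Proof.
move=> h; apply: path_homotopy_trans (path_homotopy_sym (path_concatK p r)) _.
apply: path_homotopy_trans (path_concatK p' r).
exact: path_concat_homotopyl.
Qed.

Lemma path_concat_cancell x y z (r : {path I from x to y})
    (p p' : {path I from y to z}) :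
  path_homotopy (path_concat r p) (path_concat r p') -> path_homotopy p p'.
Proof.
move=> h; apply: path_homotopy_trans (path_homotopy_sym (path_concatKl r p)) _.
apply: path_homotopy_trans (path_concatKl r p').
exact: path_concat_homotopyr.
Qed.

Lemma path_concat_range x y z (A : set X) (p : {path I from x to y})
    (r : {path I from y to z}) :
  (forall t, A (p t)) -> (forall t, A (r t)) -> forall t, A (path_concat p r t).
Proof.
move=> Ap Ar t; have [h|h] := leP (uival t) 2^-1.
  by rewrite path_concat_left.
by rewrite path_concat_right.
Qed.

End PathAlgebra.

(** * Flat sections and simple connectivity *)

(** An abstract form of path lifting over a poset: P x stands for the paths, up to
    homotopy, from a base point to x, and S u v says that following u by a descent
    from x to a point y of U x gives v.  The relation is functional and invertible
    up to homotopy; the last three fields (two out of three) express this and the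
    compatibility of descents without quotients. *)
Record transport_system (T : Type) (U : T -> set T) (P : T -> Type)
    (S : forall x y, P x -> P y -> Prop) : Prop := TransportSystem {
  transport_refl : forall x (u : P x), S _ _ u u;
  transport_down : forall x y (u : P x), U x y -> exists v : P y, S _ _ u v;
  transport_up : forall x y (v : P y), U x y -> exists u : P x, S _ _ u v;
  transport_comp : forall x y z (u : P x) (v : P y) (w : P z),
    U x y -> U y z -> S _ _ u v -> S _ _ v w -> S _ _ u w;
  transport_left : forall x y z (u : P x) (v : P y) (w : P z),
    U x y -> U y z -> S _ _ u w -> S _ _ v w -> S _ _ u v;
  transport_right : forall x y z (u : P x) (v : P y) (w : P z),
    U x y -> U y z -> S _ _ u v -> S _ _ u w -> S _ _ v w }.

Section PathTransport.
Variables (R : realType) (E : topologicalType) (U : E -> set E).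
Hypothesis nbhsU : forall e A, nbhs e A <-> U e `<=` A.
Local Notation I := (unit_interval R).
Local Notation "p ~= q" := (path_homotopy p q) (at level 70).
Local Notation "p ** q" := (path_concat p q) (at level 40).

Let Uhom := @min_nbhs_path_homotopy E U nbhsU R.
Let Upath := @min_nbhs_path E U nbhsU R.

(** The choice of the descent r from x to y does not matter, as all of them are
    homotopic by [min_nbhs_path_homotopy]. *)
Definition descends (e x y : E) (u : {path I from e to x})
    (v : {path I from e to y}) : Prop :=
  forall r : {path I from x to y}, (forall t, U x (r t)) -> u ** r ~= v.

Let concat_descends (e x y z : E) (u : {path I from e to x})
    (v : {path I from e to y}) (r : {path I from x to y})
    (s : {path I from y to z}) : u ** r ~= v -> v ** s ~= u ** (r ** s).
Proof.
move=> urv; apply: path_homotopy_sym.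
apply: path_homotopy_trans (path_concatA _ _ _) _.
exact: path_concat_homotopyl.
Qed.

Lemma descends_transport_system e :
  transport_system U (fun x y => @descends e x y).
Proof.
have trans := min_nbhs_trans nbhsU.
split=> /=.
- move=> x u r Ur; apply: path_homotopy_trans (path_concat_const u).
  apply: path_concat_homotopyr; apply: Uhom Ur _ => t.
  exact: (min_nbhs_refl nbhsU).
- move=> x y u /Upath[r Ur]; exists (u ** r) => s Us.
  by apply: path_concat_homotopyr; exact: Uhom.
- move=> x y v /Upath[r Ur]; exists (v ** path_rev r) => s Us.
  apply: path_homotopy_trans (path_concatVK v r).
  by apply: path_concat_homotopyr; exact: Uhom.
- move=> x y z u v w Uxy Uyz uv vw r Ur.
  have [a Ua] := Upath Uxy; have [b Ub] := Upath Uyz.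
  have Uab := path_concat_range Ua (fun t => trans _ _ Uxy _ (Ub t)).
  apply: path_homotopy_trans (path_concat_homotopyr u (Uhom Ur Uab)) _.
  apply: path_homotopy_trans (vw _ Ub); apply: path_homotopy_sym.
  exact/concat_descends/uv.
- move=> x y z u v w Uxy Uyz uw vw r Ur; have [b Ub] := Upath Uyz.
  have Urb := path_concat_range Ur (fun t => trans _ _ Uxy _ (Ub t)).
  apply: (@path_concat_cancelr _ _ _ _ _ _ _ b).
  apply: path_homotopy_trans (path_homotopy_sym (path_concatA _ _ _)) _.
  apply: path_homotopy_trans (uw _ Urb) _.
  exact/path_homotopy_sym/vw.
- move=> x y z u v w Uxy Uyz uv uw s Us; have [a Ua] := Upath Uxy.
  have Uas := path_concat_range Ua (fun t => trans _ _ Uxy _ (Us t)).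
  apply: path_homotopy_trans (uw _ Uas).
  exact/concat_descends/uv.
Qed.

(** Every path p from x to y satisfies g x ** p ~= g y: this holds in each U m by
    flatness, and is stable under concatenation.  Cancelling g x leaves no choice
    for p up to homotopy. *)
Lemma flat_section_homotopy e (g : forall x, {path I from e to x}) :
  (forall x y : E, U x y -> descends (g x) (g y)) ->
  forall (x y : E) (p p' : {path I from x to y}), p ~= p'.
Proof.
move=> gU x y.
suff main (p : {path I from x to y}) : g x ** p ~= g y.
  move=> p p'; apply: (@path_concat_cancell _ _ _ _ _ (g x)).
  by apply: path_homotopy_trans (main p) _; exact/path_homotopy_sym/main.
move: x y p; apply: path_local_induction => [x y p p' pp' gp|x y z p p' gp gp'|m].
- apply: path_homotopy_trans gp.
  exact/path_concat_homotopyr/path_homotopy_sym.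
- apply: path_homotopy_trans gp'; exact/path_homotopy_sym/concat_descends.
- exists (U m); first exact/nbhsU.
  move=> x y p Up.
  have Ux : U m x by rewrite -(@path_zero _ _ _ _ p).
  have Uy : U m y by rewrite -(@path_one _ _ _ _ p).
  have [a Ua] := Upath Ux.
  apply: path_homotopy_trans (gU _ _ Uy _ (path_concat_range Ua Up)).
  exact/concat_descends/gU.
Qed.

End PathTransport.

(** * Sigma is simply connected *)

Section SigmaSimplyConnected.
Variable n : nat.
Implicit Types (i : 'I_n) (j k : 'I_(2 * n)).

Lemma Sigma_nbhs (x : Sigma n) (A : set (Sigma n)) :
  nbhs x A <-> Sigma_U x `<=` A.
Proof.
have oU : open (Sigma_U x).
  by exists [set Some x]; rewrite ?bigcup_set1.
split=> [|UA]; last first.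
  apply: filterS UA _; apply: open_nbhs_nbhs; split => //.
  exact: Sigma_U_refl.
rewrite nbhsE => -[B [[D _ <-] [w Dw wx] ] BA] y xy; apply: BA.
by exists w => //; case: w Dw wx => //= z _ zx; exact: Sigma_U_sub zx _ xy.
Qed.

Lemma Sigma_U_ab i j : Sigma_U (Sa i) (Sb i j).
Proof. by left; left; exists j. Qed.

Lemma Sigma_U_a'b' j : Sigma_U (Sa' j) (Sb' j : Sigma n).
Proof. by left; right. Qed.

Lemma Sigma_U_a'b'_pred j : Sigma_U (Sa' j) (Sb' (ord_pred j) : Sigma n).
Proof. by left; left; left. Qed.

Lemma Sigma_U_a'b i j : Sigma_U (Sa' j) (Sb i j).
Proof. by right; exists i => //; left; right. Qed.

Lemma Sigma_U_b'c i j : Sigma_U (Sb' j) (Sc i j).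
Proof. by left; exists i. Qed.

Lemma Sigma_U_bc i j : Sigma_U (Sb i j) (Sc i j).
Proof. by right. Qed.

Lemma Sigma_U_bc_pred i j : Sigma_U (Sb i j) (Sc i (ord_pred j)).
Proof. by left; left. Qed.

Lemma ord_pred_val m (j : 'I_m) :
  nat_of_ord (ord_pred j) = if nat_of_ord j == 0%N then m.-1 else j.-1.
Proof.
have jm := ltn_ord j; rewrite /ord_pred /=; case: eqP => [->|j0].
  by rewrite add0n modn_small// prednK //; lia.
have -> : (j + m).-1 = (j.-1 + m)%N by lia.
by rewrite modnDr modn_small//; lia.
Qed.

(** The values are chosen in an order in which each new piece of Sigma meets the
    preceding ones in a connected set.  From u0 at a_(i0) one descends to b_(i0,j)
    and c_(i0,j) (these are b0 and c0), climbs from c_(i0,j) to b'_j and from b'_j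
    to a'_j, and descends again from there to all c_(i,j) and b_(i,j).  Two
    relations are not built in.  That a'_j descends to b'_(j-1), its other
    neighbour, holds as both are joined to the cone over the circle of index i0,
    through b_(i0,j).  That a_i, defined from b_(i,0), descends to every b_(i,j)
    follows by walking along the circle of index i. *)
Lemma Sigma_flat_section (P : Sigma n -> Type)
    (S : forall x y, P x -> P y -> Prop) i0 :
  transport_system (@Sigma_U n) S -> P (Sa i0) ->
  exists g : forall x, P x, forall x y, Sigma_U x y -> S _ _ (g x) (g y).
Proof.
move=> ts u0.
have Sdown x y (xy : Sigma_U x y) (u : P x) : {v : P y | S _ _ u v}.
  exact/cid/(transport_down ts).
have Sup x y (xy : Sigma_U x y) (v : P y) : {u : P x | S _ _ u v}.
  exact/cid/(transport_up ts).
have comp x y z u v w (xy : Sigma_U x y) (yz : Sigma_U y z) :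
  S x y u v -> S y z v w -> S x z u w by exact: (transport_comp ts).
have left x y z u v w (xy : Sigma_U x y) (yz : Sigma_U y z) :
  S x z u w -> S y z v w -> S x y u v by exact: (transport_left ts).
have right x y z u v w (xy : Sigma_U x y) (yz : Sigma_U y z) :
  S x y u v -> S x z u w -> S y z v w by exact: (transport_right ts).
pose b0 j := sval (Sdown _ _ (Sigma_U_ab i0 j) u0).
have Sab0 j : S _ _ u0 (b0 j) := svalP (Sdown _ _ (Sigma_U_ab i0 j) u0).
have Uac i j : Sigma_U (Sa i) (Sc i j).
  by left; right; exists j.
pose c0 j := sval (Sdown _ _ (Uac i0 j) u0).
have Sac0 j : S _ _ u0 (c0 j) := svalP (Sdown _ _ (Uac i0 j) u0).
have Sbc0 j : S _ _ (b0 j) (c0 j).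
  exact: right (Sigma_U_ab _ _) (Sigma_U_bc _ _) (Sab0 j) (Sac0 j).
have Sbc0_pred j : S _ _ (b0 j) (c0 (ord_pred j)).
  exact: right (Sigma_U_ab _ _) (Sigma_U_bc_pred _ _) (Sab0 j) (Sac0 _).
pose b' j := sval (Sup _ _ (Sigma_U_b'c i0 j) (c0 j)).
have Sb'c0 j : S _ _ (b' j) (c0 j) := svalP (Sup _ _ (Sigma_U_b'c i0 j) (c0 j)).
pose c i j := sval (Sdown _ _ (Sigma_U_b'c i j) (b' j)).
have Sb'c i j : S _ _ (b' j) (c i j) := svalP (Sdown _ _ (Sigma_U_b'c i j) (b' j)).
pose a' j := sval (Sup _ _ (Sigma_U_a'b' j) (b' j)).
have Sa'b' j : S _ _ (a' j) (b' j) := svalP (Sup _ _ (Sigma_U_a'b' j) (b' j)).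
pose b i j := sval (Sdown _ _ (Sigma_U_a'b i j) (a' j)).
have Sa'b i j : S _ _ (a' j) (b i j) := svalP (Sdown _ _ (Sigma_U_a'b i j) (a' j)).
have Sa'b'_pred j : S _ _ (a' j) (b' (ord_pred j)).
  have a'c0 : S _ _ (a' j) (c0 j).
    exact: comp (Sigma_U_a'b' _) (Sigma_U_b'c _ _) (Sa'b' j) (Sb'c0 j).
  have a'b0 : S _ _ (a' j) (b0 j).
    exact: left (Sigma_U_a'b _ _) (Sigma_U_bc _ _) a'c0 (Sbc0 j).
  have a'c0_pred : S _ _ (a' j) (c0 (ord_pred j)).
    exact: comp (Sigma_U_a'b _ _) (Sigma_U_bc_pred _ _) a'b0 (Sbc0_pred j).
  exact: left (Sigma_U_a'b'_pred _) (Sigma_U_b'c _ _) a'c0_pred (Sb'c0 _).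
have Sa'c i j : S _ _ (a' j) (c i j).
  exact: comp (Sigma_U_a'b' _) (Sigma_U_b'c _ _) (Sa'b' j) (Sb'c i j).
have Sa'c_pred i j : S _ _ (a' j) (c i (ord_pred j)).
  exact: comp (Sigma_U_a'b'_pred _) (Sigma_U_b'c _ _) (Sa'b'_pred j) (Sb'c i _).
have Sbc i j : S _ _ (b i j) (c i j).
  exact: right (Sigma_U_a'b _ _) (Sigma_U_bc _ _) (Sa'b i j) (Sa'c i j).
have Sbc_pred i j : S _ _ (b i j) (c i (ord_pred j)).
  exact: right (Sigma_U_a'b _ _) (Sigma_U_bc_pred _ _) (Sa'b i j) (Sa'c_pred i j).
have n2_gt0 : (0 < 2 * n)%N by have := ltn_ord i0; lia.
pose j0 := Ordinal n2_gt0.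
pose a i := sval (Sup _ _ (Sigma_U_ab i j0) (b i j0)).
have Sab_0 i : S _ _ (a i) (b i j0) := svalP (Sup _ _ (Sigma_U_ab i j0) (b i j0)).
have Sab i j : S _ _ (a i) (b i j).
  have [m jm] : exists m, nat_of_ord j = m by exists j.
  elim: m j jm => [|m IH] j jm; first by rewrite (_ : j = j0) //; exact: val_inj.
  have pm : nat_of_ord (ord_pred j) = m by rewrite ord_pred_val jm.
  have ac : S _ _ (a i) (c i (ord_pred j)).
    exact: comp (Sigma_U_ab _ _) (Sigma_U_bc _ _) (IH _ pm) (Sbc _ _).
  exact: left (Sigma_U_ab _ _) (Sigma_U_bc_pred _ _) ac (Sbc_pred _ _).
have Sac i j : S _ _ (a i) (c i j).
  exact: comp (Sigma_U_ab _ _) (Sigma_U_bc _ _) (Sab i j) (Sbc i j).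
exists (fun x => match x return P x with
  | Sa i => a i | Sa' j => a' j | Sb' j => b' j | Sb i j => b i j
  | Sc i j => c i j end).
have refl x (u : P x) : S _ _ u u by exact: (transport_refl ts).
move=> [i|i|i|i j|i j] y /=.
- by move=> [[[j _ <-]|[j _ <-]]|->].
- by move=> [[[->|->]|->]|[j _ [[->|->]|->]]].
- by move=> [[k _ <-]|->].
- by move=> [[->|->]|->].
- by move=> ->.
Qed.

Lemma Sigma_simply_connected (R : realType) i0 :
  exists g : forall x y : Sigma n, {path unit_interval R from x to y},
    forall x y (p : {path unit_interval R from x to y}), path_homotopy p (g x y).
Proof.
have [g gU] := Sigma_flat_section
  (descends_transport_system R Sigma_nbhs (Sa i0)) (path_const R (Sa i0)).
exists (fun x y => path_concat (path_rev (g x)) (g y)) => x y p.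
exact: (flat_section_homotopy Sigma_nbhs gU).
Qed.

End SigmaSimplyConnected.

(** * The deck transformations of Sigma *)

Section CyclicShift.
Local Open Scope nat_scope.
Variable m : nat.
Implicit Types i : 'I_m.

(** Translation by k in the integers mod m. *)
Definition ord_shift (k : nat) i : 'I_m :=
  Ordinal (ltn_pmod (i + k) (leq_ltn_trans (leq0n i) (ltn_ord i))).

Lemma ord_shiftD k l i : ord_shift k (ord_shift l i) = ord_shift (k + l) i.
Proof. by apply: val_inj; rewrite /= modnDml addnAC addnA. Qed.

Lemma ord_shift_eq k l i :
  ord_shift k i = ord_shift l i <-> k = l %[mod m].
Proof.
split=> [[/eqP]|kl]; first by rewrite eqn_modDl => /eqP.
by apply: val_inj; rewrite /= -modnDmr kl modnDmr.
Qed.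

(** As i < m, the natural number j + m - i is not truncated. *)
Lemma ord_shift_sub i (j : 'I_m) : ord_shift (j + m - i) i = j.
Proof.
have im := ltn_ord i; apply: val_inj => /=.
by rewrite subnKC ?modnDr ?modn_small//; lia.
Qed.

Lemma ord_shift_pred k i : ord_shift k (ord_pred i) = ord_pred (ord_shift k i).
Proof.
have im := ltn_ord i; apply: val_inj => /=.
rewrite modnDml.
have -> : (i + m).-1 + k = (i + k) + m.-1 by lia.
have -> : ((i + k) %% m + m).-1 = (i + k) %% m + m.-1 by lia.
by rewrite modnDml.
Qed.

End CyclicShift.

Section Deck.
Variable n : nat.
Local Open Scope nat_scope.

(** The k-th power of the generating shift; the second index moves twice as fast. *)
Definition deck (k : nat) (x : Sigma n) : Sigma n :=
  match x with
  | Sa i => Sa (ord_shift k i)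
  | Sa' j => Sa' (ord_shift (2 * k) j)
  | Sb' j => Sb' (ord_shift (2 * k) j)
  | Sb i j => Sb (ord_shift k i) (ord_shift (2 * k) j)
  | Sc i j => Sc (ord_shift k i) (ord_shift (2 * k) j)
  end.

Lemma deckD k l x : deck k (deck l x) = deck (k + l) x.
Proof. by case: x => *; rewrite /= !ord_shiftD ?mulnDr. Qed.

Lemma modn_double k l : 2 * k = 2 * l %[mod 2 * n] <-> k = l %[mod n].
Proof. by rewrite -!muln_modr; split=> [|->//]; lia. Qed.

Lemma deck_eq k l x : deck k x = deck l x <-> k = l %[mod n].
Proof.
split=> [|kl].
  have addI i m u v : i + u = i + v %[mod m] -> u = v %[mod m].
    by move/eqP; rewrite eqn_modDl => /eqP.
  by case: x => [i|j|j|i j|i j] [] => [/addI|/addI/modn_double|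
    /addI/modn_double|/addI + _|/addI + _].
have os i : ord_shift k i = ord_shift l i :> 'I_n by exact/ord_shift_eq.
have os2 j : ord_shift (2 * k) j = ord_shift (2 * l) j :> 'I_(2 * n).
  exact/ord_shift_eq/modn_double.
by case: x => [i|j|j|i j|i j] /=; rewrite ?os ?os2.
Qed.

Lemma deck_U k x y : Sigma_U x y -> Sigma_U (deck k x) (deck k y).
Proof.
case: x => [i|j|j|i j|i j] /=.
- move=> [[[j _ <-]|[j _ <-]]|->]; last by right.
    by left; left; exists (ord_shift (2 * k) j).
  by left; right; exists (ord_shift (2 * k) j).
- move=> [[[->|->]|->]|[i _ [[->|->]|->]]] /=; rewrite ?ord_shift_pred.
  + by left; left; left.
  + by left; left; right.
  + by left; right.
  + by right; exists (ord_shift k i) => //; left; left.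
  + by right; exists (ord_shift k i) => //; left; right.
  + by right; exists (ord_shift k i) => //; right.
- by move=> [[i _ <-]|->]; [left; exists (ord_shift k i)|right].
- move=> [[->|->]|->] /=; rewrite ?ord_shift_pred; [|by left; right|by right].
  by left; left.
- by move=> ->.
Qed.

Let sim_mod (i j s t : nat) :
  (2%:Z * (j%:Z - i%:Z) == t%:Z - s%:Z %[mod (2 * n)%:Z])%Z =
  (2 * j + s == 2 * i + t %[mod 2 * n]).
Proof.
rewrite -eqz_nat -!modz_nat !eqz_mod_dvd; congr (dvdz _ _).
by lia.
Qed.

Lemma Sigma_sim_bE (i j : 'I_n) (s t : 'I_(2 * n)) :
  Sigma_sim (Sb i s) (Sb j t) = (2 * j + s == 2 * i + t %[mod 2 * n]).
Proof. exact: sim_mod. Qed.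

Lemma Sigma_sim_cE (i j : 'I_n) (s t : 'I_(2 * n)) :
  Sigma_sim (Sc i s) (Sc j t) = (2 * j + s == 2 * i + t %[mod 2 * n]).
Proof. exact: sim_mod. Qed.

Lemma Sigma_sim_a'E (i j : 'I_(2 * n)) :
  Sigma_sim (Sa' i) (Sa' j : Sigma n) = (i == j %[mod 2]).
Proof. by []. Qed.

Lemma Sigma_sim_b'E (i j : 'I_(2 * n)) :
  Sigma_sim (Sb' i) (Sb' j : Sigma n) = (i == j %[mod 2]).
Proof. by []. Qed.

Definition Sigma_simE :=
  (Sigma_sim_a'E, Sigma_sim_b'E, Sigma_sim_bE, Sigma_sim_cE).

Lemma deck_sim k (x : Sigma n) : Sigma_sim x (deck k x).
Proof.
have par (j : nat) : j = (j + 2 * k) %% (2 * n) %[mod 2].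
  by rewrite modn_dvdm ?dvdn_mulr// -modnDmr modnMr addn0.
have lin (i s : nat) :
    2 * ((i + k) %% n) + s == 2 * i + (s + 2 * k) %% (2 * n) %[mod 2 * n].
  by rewrite muln_modr modnDml modnDmr; apply/eqP; congr (_ %% _); lia.
case: x => [i|j|j|i s|i s]; rewrite /deck ?Sigma_simE //=;
  exact/eqP/par.
Qed.

Lemma sim_deck (x y : Sigma n) : Sigma_sim x y -> exists k, y = deck k x.
Proof.
have par (i j : 'I_(2 * n)) : i == j %[mod 2] ->
    ord_shift (2 * ((j + 2 * n - i) %/ 2)) i = j.
  move=> /eqP ij; have im := ltn_ord i.
  have -> : 2 * ((j + 2 * n - i) %/ 2) = j + 2 * n - i by lia.
  exact: ord_shift_sub.
have lin (i j : 'I_n) (s t : 'I_(2 * n)) : 2 * j + s == 2 * i + t %[mod 2 * n] ->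
    ord_shift (2 * (j + n - i)) s = t.
  move=> /eqP h; have im := ltn_ord i; apply: val_inj => /=.
  rewrite -[RHS](modn_small (ltn_ord t)); apply/eqP.
  rewrite -(eqn_modDl (2 * i)) -h.
  by rewrite (_ : 2 * i + _ = 2 * j + s + 2 * n) ?modnDr//; lia.
case: x y => [i|i|i|i s|i s] [j|j|j|j t|j t] //; rewrite ?Sigma_simE /=.
- by move=> _; exists (j + n - i); rewrite /= ord_shift_sub.
- by move=> /par ij; exists ((j + 2 * n - i) %/ 2); rewrite /= ij.
- by move=> /par ij; exists ((j + 2 * n - i) %/ 2); rewrite /= ij.
- by move=> /lin st; exists (j + n - i); rewrite /= st ord_shift_sub.
- by move=> /lin st; exists (j + n - i); rewrite /= st ord_shift_sub.
Qed.

Lemma eq_mod_cases (m a b : nat) : a == b %[mod m] -> a < 2 * m -> b < 2 * m ->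
  [\/ a = b, a = b + m | b = a + m].
Proof.
move=> /eqP ab am bm; have m0 : 0 < m by lia.
have half c : c < 2 * m -> c %% m = c \/ c %% m = c - m /\ m <= c.
  move=> cm; have [c_m|m_c] := ltnP c m; first by left; rewrite modn_small.
  right; split=> //; rewrite -[in LHS](subnK m_c) modnDr modn_small//; lia.
have [ha|[ha ?]] := half a am; have [hb|[hb ?]] := half b bm.
- by apply: Or31; lia.
- by apply: Or33; lia.
- by apply: Or32; lia.
- by apply: Or31; lia.
Qed.

(** Both sides are less than twice the modulus, so the congruence is a choice
    between three linear equations. *)
Lemma Sigma_sim_cases (i j : 'I_n) (s t : 'I_(2 * n)) :
  2 * j + s == 2 * i + t %[mod 2 * n] ->
  [\/ 2 * j + s = 2 * i + t, 2 * j + s = 2 * i + t + 2 * n |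
      2 * i + t = 2 * j + s + 2 * n].
Proof.
have ? := ltn_ord i; have ? := ltn_ord j; have ? := ltn_ord s.
by have ? := ltn_ord t; move/eq_mod_cases; apply; lia.
Qed.

Lemma sim_same_row (i : 'I_n) (s t : 'I_(2 * n)) :
  2 * i + s == 2 * i + t %[mod 2 * n] -> s = t.
Proof. by rewrite eqn_modDl !modn_small// => /eqP/val_inj. Qed.

Lemma sim_same_column (i j : 'I_n) (s : 'I_(2 * n)) :
  2 * j + s == 2 * i + s %[mod 2 * n] -> i = j.
Proof.
have ? := ltn_ord i; have ? := ltn_ord j; have ? := ltn_ord s.
by move=> /Sigma_sim_cases[] ?; apply: val_inj => /=; lia.
Qed.

(** The modulus being even, j and j - 1 have different parities also when j = 0. *)
Lemma ord_pred_parity (s : 'I_(2 * n)) : ord_pred s %% 2 <> s %% 2.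
Proof. by rewrite ord_pred_val; have := ltn_ord s; case: eqP; lia. Qed.

Lemma sim_parity (i j : 'I_n) (s t : 'I_(2 * n)) :
  2 * j + s == 2 * i + t %[mod 2 * n] -> s = t %[mod 2].
Proof. by move=> /Sigma_sim_cases[] ?; lia. Qed.

(** In U_(a_i) and U_(b_(i,j)) the first index is fixed, in U_(b'_j) the second.
    In U_(a'_j) the second index is j or j - 1, and the relation sees its parity:
    the two cannot be confused, and a given one determines the first index. *)
Lemma Sigma_sim_inj (e x y : Sigma n) :
  Sigma_U e x -> Sigma_U e y -> Sigma_sim x y -> x = y.
Proof.
case: e => [i|j|j|i j|i j] /=.
- move=> [[[s _ <-]|[s _ <-]]|->] [[[t _ <-]|[t _ <-]]|->] //;
    by rewrite Sigma_simE => /sim_same_row ->.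
- have pred_j := @ord_pred_parity j.
  move=> [[[->|->]|->]|[k _ [[->|->]|->]]] [[[->|->]|->]|[l _ [[->|->]|->]]] //;
  rewrite Sigma_simE; by
    first [move=> /eqP/pred_j | move=> /eqP/esym/pred_j
          | move=> /sim_same_column -> | move=> /sim_parity/pred_j
          | move=> /sim_parity/esym/pred_j].
- move=> [[k _ <-]|->] [[l _ <-]|->] //.
  by rewrite Sigma_simE => /sim_same_column ->.
- have pred_j := @ord_pred_parity j.
  move=> [[->|->]|->] [[->|->]|->] //; rewrite ?Sigma_simE => /sim_parity.
    by move=> /pred_j.
  by move=> /esym/pred_j.
- by move=> -> ->.
Qed.

(** A common point of B or C fixes the first index of the points of type a or b
    above it.  The points of type a' above a common point have equal or
    consecutive indices, and the relation excludes the latter by parity. *)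
Lemma Sigma_sim_sep (e e' x : Sigma n) :
  Sigma_U e x -> Sigma_U e' x -> Sigma_sim e e' -> e = e'.
Proof.
case: e e' => [i|i|i|i s|i s] [j|j|j|j t|j t] //.
- by move=> [[[s _ <-]|[s _ <-]]|->] [[[t _ []]|[t _ []]]|[]] // ->.
- have pred_inj (u v : 'I_(2 * n)) :
      (u + 2 * n).-1 = (v + 2 * n).-1 %[mod 2 * n] -> u = v.
    move=> uv; have /(congr1 (@ordS _)) : ord_pred u = ord_pred v.
      exact: val_inj.
    by rewrite !ord_predK.
  have pred_i := @ord_pred_parity i; have pred_j := @ord_pred_parity j.
  rewrite Sigma_simE.
  move=> [[[->|->]|->]|[k _ [[->|->]|->]]] [[[[]|[]]|[]]|[l _ [[[]|[]]|[]]]] //;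
  first [by move=> -> | by move=> _ -> | by move=> /pred_inj ->
    | by move=> _ /pred_inj -> | by move=> <- /eqP/esym/pred_i
    | by move=> _ <- /eqP/esym/pred_i | by move=> -> /eqP/pred_j
    | by move=> _ -> /eqP/pred_j].
- by move=> [[k _ <-]|->] [[l _ []]|[]] // => [_|] ->.
- move=> + + h; have {}h : i = j -> Sb i s = Sb j t.
    by move=> ij; move: h; rewrite ij Sigma_simE => /sim_same_row ->.
  by move=> [[->|->]|->] [[[]|[]]|[]] // /h.
- by move=> -> [-> ->].
Qed.

End Deck.

(** * The projection is a covering *)

Section SigmaCovering.
Variable n : nat.
Local Open Scope quotient_scope.

Definition Sigma_proj (x : Sigma n) : SigmaQ n :=
  \pi_{eq_quot (Sigma_sim_equiv n)} x.

Lemma Sigma_projP x y : Sigma_proj x = Sigma_proj y <-> Sigma_sim x y.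
Proof. by split=> [/eqmodP|h]; last exact/eqmodP. Qed.

Lemma Sigma_proj_continuous : continuous Sigma_proj.
Proof. exact: pi_continuous. Qed.

Lemma Sigma_proj_deck k x : Sigma_proj (deck k x) = Sigma_proj x.
Proof. exact/esym/Sigma_projP/deck_sim. Qed.

Lemma deck_continuous k : continuous (@deck n k).
Proof.
apply/(min_nbhs_continuous (@Sigma_nbhs n)) => x.
by apply/Sigma_nbhs => y; exact: deck_U.
Qed.

Lemma Sigma_covering : min_covering (@Sigma_U n) Sigma_proj.
Proof.
have sheet e z w : Sigma_U e w -> Sigma_proj z = Sigma_proj w ->
    exists2 e', Sigma_proj e' = Sigma_proj e & Sigma_U e' z.
  move=> ew /esym/Sigma_projP/sim_deck[k ->]; exists (deck k e).
    exact: Sigma_proj_deck.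
  exact: deck_U.
split=> //.
- exact: Sigma_nbhs.
- exact: Sigma_proj_continuous.
- move=> x; exists (repr (x : {eq_quot (Sigma_sim_equiv n)})).
  exact: reprK.
- move=> e; apply: open_nbhs_nbhs; split; last first.
    by exists e => //; exact: Sigma_U_refl.
  rewrite /open /= /quotient_open openE => z [w ew wz].
  have [e' ee' e'z] := sheet _ _ _ ew (esym wz).
  apply/Sigma_nbhs => v zv; have e'v := Sigma_U_sub e'z zv.
  have /Sigma_projP/sim_deck[k ->] := ee'.
  by exists (deck k v); [exact: deck_U|exact: Sigma_proj_deck].
- by move=> e z z' ez ez' /Sigma_projP; exact: Sigma_sim_inj ez ez'.
- by move=> e e' z ez e'z /Sigma_projP; exact: Sigma_sim_sep ez e'z.
Qed.

End SigmaCovering.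

(** * The image of a path under a map *)

Section PathImage.
Variables (R : realType) (X Y : topologicalType).
Local Notation I := (unit_interval R).
Variables (f : X -> Y) (cf : continuous f).

Definition path_image x y (p : {path I from x to y}) (x' y' : Y)
    (fx : f x = x') (fy : f y = y') : {path I from x' to y'} :=
  to_path (cts_comp (@cts_fun _ _ p) cf)
    (etrans (congr1 f path_zero) fx) (etrans (congr1 f path_one) fy).

Lemma path_imageE x y (p : {path I from x to y}) x' y' (fx : f x = x')
  (fy : f y = y') t : path_image p fx fy t = f (p t).
Proof. by []. Qed.

Lemma path_image_homotopy x y (p p' : {path I from x to y}) x' y'
    (fx : f x = x') (fy : f y = y') :
  path_homotopy p p' -> path_homotopy (path_image p fx fy) (path_image p' fx fy).
Proof.
move=> [H [cH H0 H1 Hx Hy]]; exists (fun a => f (H a)); split.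
- exact: (cts_comp cH cf).
- by move=> t; rewrite H0.
- by move=> t; rewrite H1.
- by move=> s; rewrite Hx.
- by move=> s; rewrite Hy.
Qed.

Lemma path_image_concat x y z (p : {path I from x to y})
    (r : {path I from y to z}) x' y' z'
    (fx : f x = x') (fy : f y = y') (fz : f z = z') :
  path_image (path_concat p r) fx fz =
  path_concat (path_image p fx fy) (path_image r fy fz).
Proof.
apply/path_eqP => t; rewrite path_imageE.
have [h|h] := leP (uival t) 2^-1; first by rewrite !path_concat_left.
by rewrite !path_concat_right.
Qed.

End PathImage.

(** * The fundamental group of the quotient *)

Section FundamentalGroupSigmaQ.
Variables (R : realType) (n : nat) (n_gt1 : (1 < n)%N).
Local Notation I := (unit_interval R).

Let i0 : 'I_n := Ordinal (ltnW n_gt1).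

Variables (x : SigmaQ n) (e : Sigma n) (ex : Sigma_proj e = x).

Let deck_over k : Sigma_proj (deck k e) = x.
Proof. by rewrite Sigma_proj_deck. Qed.

(** The class of the loop at x that lifts to p. *)
Definition lifted_class y (yx : Sigma_proj y = x) (p : {path I from e to y}) :
    pi1 R x :=
  loop_class (path_image (@Sigma_proj_continuous n) p ex yx).

(** Homotopic loops have lifts with the same end; conversely, two paths of Sigma
    with the same ends are homotopic. *)
Lemma lifted_class_eq y y' (yx : Sigma_proj y = x) (yx' : Sigma_proj y' = x)
    (p : {path I from e to y}) (p' : {path I from e to y'}) :
  lifted_class yx p = lifted_class yx' p' <-> y = y'.
Proof.
split=> [/loop_classP pp'|yy'].
  suff : p one = p' one by rewrite !path_one.
  apply: (lift_homotopy_endpoint (Sigma_covering n) pp'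
    (@cts_fun _ _ p) (@cts_fun _ _ p')) => [t|t|]; rewrite ?path_imageE//.
  by rewrite [LHS]path_zero [RHS]path_zero.
subst y'; apply/loop_classP; rewrite (Prop_irrelevance yx' yx).
have [g gP] := Sigma_simply_connected R i0.
apply: path_image_homotopy; apply: path_homotopy_trans (gP _ _ p) _.
exact/path_homotopy_sym/gP.
Qed.

Lemma lifted_class_surj (u : pi1 R x) :
  exists y (yx : Sigma_proj y = x) (p : {path I from e to y}),
    lifted_class yx p = u.
Proof.
elim/pi1P: u => p.
have [g [cg g0 qg]] : exists g : I -> Sigma n,
    [/\ continuous g, g zero = e & forall t, Sigma_proj (g t) = p t].
  apply: (path_lifting (Sigma_covering n) (@cts_fun _ _ p)).
  by rewrite ex; exact/esym/path_zero.
have g1 : Sigma_proj (g one) = x by rewrite qg; exact: path_one.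
exists (g one), g1, (to_path cg g0 erefl).
by congr loop_class; apply/path_eqP => t; rewrite path_imageE to_pathE.
Qed.

Let deck_path k : {path I from e to deck k e} :=
  sval (cid (Sigma_simply_connected R i0)) e (deck k e).

Definition deck_class (k : nat) : pi1 R x :=
  lifted_class (deck_over k) (deck_path k).

Lemma deck_class_eq k l : deck_class k = deck_class l <-> k = l %[mod n].
Proof. by rewrite /deck_class lifted_class_eq deck_eq. Qed.

Lemma deck_class_surj u : exists k, deck_class k = u.
Proof.
have [y [yx [p <-]]] := lifted_class_surj u.
have /sim_deck[k yE] : Sigma_sim e y by apply/Sigma_projP; rewrite ex.
by exists k; apply/lifted_class_eq.
Qed.

(** The path from e to its shift by k, followed by the shift by k of the path from
    e to its shift by l, ends at the shift of e by k + l; its image is the product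
    of the two loops because shifting does not change images. *)
Lemma deck_classD k l : deck_class (k + l) = (deck_class k * deck_class l)%g.
Proof.
rewrite /deck_class -[RHS]/(pi1_mul _ _) -loop_class_concat.
pose shifted := path_image (@deck_continuous n k) (deck_path l) erefl (deckD k l e).
rewrite (_ : path_image _ (deck_path l) _ _ =
  path_image (@Sigma_proj_continuous n) shifted (deck_over k) (deck_over (k + l))).
  by rewrite -path_image_concat; exact/lifted_class_eq.
by apply/path_eqP => t; rewrite !path_imageE Sigma_proj_deck.
Qed.

End FundamentalGroupSigmaQ.

Theorem mainTheorem2 (R : realType) (n : nat) (n_gt1 : (1 < n)%N)
    (x : SigmaQ n) :
  exists f : pi1 R x -> 'Z_n,
    bijective f /\ {morph f : p q / (p * q)%g >-> p + q}.
Proof.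
have [e ex] := cov_surj (Sigma_covering n) x.
pose psi (k : 'Z_n) := deck_class R n_gt1 ex k.
have lt_n (k : 'Z_n) : (k < n)%N.
  by rewrite -[X in (_ < X)%N](Zp_cast n_gt1).
have psi_inj : injective psi.
  by move=> k l /deck_class_eq; rewrite !modn_small// => /val_inj.
have psi_surj u : exists k, psi k = u.
  have [k <-] := deck_class_surj n_gt1 ex u.
  exists (inZp k); apply/deck_class_eq => /=.
  by rewrite Zp_cast// modn_mod.
have psiD k l : psi (k + l) = (psi k * psi l)%g.
  rewrite /psi -deck_classD; apply/deck_class_eq => /=.
  by rewrite [X in (_ %% X)%N = _ %[mod _] ]Zp_cast// modn_mod.
have /choice[f fK] := psi_surj.
have psiK : cancel psi f by move=> k; apply: psi_inj; rewrite fK.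
exists f; split; first by exists psi.
by move=> p q; apply: psi_inj; rewrite fK psiD !fK.
Qed.
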